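(* Let $R$ be a commutative arithmetical ring and $Q$ its quotient ring. Then the following conditions are equivalent: (1) $Q$ is pure-semisimple; (2) each flat $R$-module is semi-compact; (3) each flat $R$-module is finitely projective; (4) each flat $R$-module is singly projective.
   Context: Rings are associative with identity and modules are unitary. A commutative ring $R$ is arithmetical if for each maximal ideal $L$ the ideals of $R_L$ are totally ordered by inclusion. The quotient ring of a commutative ring $R$ is its total ring of fractions (localization at the set of all regular elements). A ring is (left) pure-semisimple if each left module over it is pure-injective, i.e. injective relative to every pure exact sequence (a short exact sequence relative to which every finitely presented module is projective). For an $R$-module $M$ and an ideal $I$, $M[I]=\{m\in M\mid Im=0\}$. $M$ is semi-compact if every set of congruences $x\equiv x_\alpha\pmod{M[I_\alpha]}$ ($\alpha\in\Lambda$, $x_\alpha\in M$, $I_\alpha$ an ideal of $R$), each finite subset of which has a common solution in $M$, has a simultaneous solution in $M$. $M$ is finitely projective (respectively singly projective) if every homomorphism from a finitely generated (respectively cyclic) $R$-module into $M$ factors through a free $R$-module. *)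

(* Defs.v *)
From HB Require Import structures.
From mathcomp Require Import all_boot all_order all_algebra.
From mathcomp Require Import generic_quotient ring.
From mathcomp Require Import boolp classical_sets cardinality.

(* Rings are [comPzRingType]/[pzRingType], so that the zero ring is not excluded. *)

Set Implicit Arguments.
Unset Strict Implicit.
Unset Printing Implicit Defensive.

Import GRing.Theory.
Local Open Scope ring_scope.
Local Open Scope quotient_scope.
Local Open Scope classical_set_scope.

Section Ideals.
Variable R : comPzRingType.

Definition is_ideal (I : set R) : Prop :=
  [/\ I 0, (forall x y, I x -> I y -> I (x + y)) & (forall a x, I x -> I (a * x))].

Definition maximal_ideal (L : set R) : Prop :=
  [/\ is_ideal L, L <> setT &
      forall J : set R, is_ideal J -> L `<=` J -> J = L \/ J = setT].

Definition ideals_totally_ordered : Prop :=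
  forall I J : set R, is_ideal I -> is_ideal J -> I `<=` J \/ J `<=` I.

End Ideals.

Record mulSubset (R : comPzRingType) := MulSubset {
  mulset : set R;
  mulset1 : mulset 1;
  mulsetM : forall x y, mulset x -> mulset y -> mulset (x * y) }.

(* [localization S] is S^-1 R: classes of pairs a / s with s in S, where        *)
(* a / s = b / t iff u (a t) = u (b s) for some u in S (see mklocP).            *)
Section Localization.
Variables (R : comPzRingType) (S : mulSubset R).
Local Notation inS := (mulset S).

Definition fracpair := {x : R * R | `[< inS x.2 >]}.
HB.instance Definition _ := Choice.on fracpair.

Implicit Types x y z : fracpair.

Definition fnum x : R := (val x).1.
Definition fden x : R := (val x).2.

Lemma fdenP x : inS (fden x).
Proof. exact: asboolW (valP x). Qed.

Definition mkfrac (a s : R) (Ss : inS s) : fracpair :=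
  exist _ (a, s) (asboolT Ss).

Definition frac_rel x y : bool :=
  `[< exists2 u, inS u & u * (fnum x * fden y) = u * (fnum y * fden x) >].

Lemma frac_rel_refl : reflexive frac_rel.
Proof. by move=> x; apply/asboolP; exists 1 => //; exact: mulset1. Qed.

Lemma frac_rel_sym : symmetric frac_rel.
Proof. by move=> x y; apply/asboolP/asboolP => -[u Su e]; exists u. Qed.

Lemma frac_rel_trans : transitive frac_rel.
Proof.
move=> y x z /asboolP[u Su e1] /asboolP[v Sv e2]; apply/asboolP.
exists (u * v * fden y); first by apply: mulsetM (fdenP y); exact: mulsetM.
transitivity (v * fden z * (u * (fnum x * fden y))); first by ring.
by rewrite e1; transitivity (u * fden x * (v * (fnum y * fden z)));
  [ring | rewrite e2; ring].
Qed.

Canonical frac_equiv :=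
  EquivRel frac_rel frac_rel_refl frac_rel_sym frac_rel_trans.

Definition localization := {eq_quot frac_rel}.
HB.instance Definition _ : EqQuotient _ frac_rel localization :=
  EqQuotient.on localization.
HB.instance Definition _ := Choice.on localization.

Definition mkloc (a s : R) (Ss : inS s) : localization :=
  \pi_localization (mkfrac a Ss).

Lemma mklocP a s (Ss : inS s) b t (St : inS t) :
  mkloc a Ss = mkloc b St <-> exists2 u, inS u & u * (a * t) = u * (b * s).
Proof.
split; first by move=> /eqmodP /asboolP.
by move=> h; apply/eqmodP/asboolP.
Qed.

Lemma mkloc_repr (p : localization) : mkloc (fnum (repr p)) (fdenP (repr p)) = p.
Proof.
rewrite -[RHS]reprK /mkloc; congr (\pi_localization _); apply: val_inj.
by case: (repr p) => -[].
Qed.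

Lemma mkloc_ind (P : localization -> Prop) :
  (forall a s (Ss : inS s), P (mkloc a Ss)) -> forall p, P p.
Proof. by move=> h p; rewrite -(mkloc_repr p). Qed.

Lemma repr_mkloc a s (Ss : inS s) : let x := repr (mkloc a Ss) in
  exists2 u, inS u & u * (fnum x * s) = u * (a * fden x).
Proof.
move=> x; apply/(mklocP (fnum x) (fdenP x) a Ss); exact: mkloc_repr.
Qed.

Definition loc_add (p q : localization) : localization :=
  let x := repr p in let y := repr q in
  mkloc (fnum x * fden y + fnum y * fden x) (mulsetM (fdenP x) (fdenP y)).

Definition loc_mul (p q : localization) : localization :=
  let x := repr p in let y := repr q in
  mkloc (fnum x * fnum y) (mulsetM (fdenP x) (fdenP y)).

Definition loc_opp (p : localization) : localization :=
  let x := repr p in mkloc (- fnum x) (fdenP x).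

Definition loc0 : localization := mkloc 0 (mulset1 S).
Definition loc1 : localization := mkloc 1 (mulset1 S).

Lemma loc_addE a s (Ss : inS s) b t (St : inS t) :
  loc_add (mkloc a Ss) (mkloc b St) = mkloc (a * t + b * s) (mulsetM Ss St).
Proof.
have [u Su e1] := repr_mkloc a Ss; have [v Sv e2] := repr_mkloc b St.
apply/mklocP; exists (u * v); first exact: mulsetM.
set x := repr (mkloc a Ss) in e1 *; set y := repr (mkloc b St) in e2 *.
transitivity (v * t * fden y * (u * (fnum x * s)) +
              u * s * fden x * (v * (fnum y * t))); first by ring.
by rewrite e1 e2; ring.
Qed.

Lemma loc_mulE a s (Ss : inS s) b t (St : inS t) :
  loc_mul (mkloc a Ss) (mkloc b St) = mkloc (a * b) (mulsetM Ss St).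
Proof.
have [u Su e1] := repr_mkloc a Ss; have [v Sv e2] := repr_mkloc b St.
apply/mklocP; exists (u * v); first exact: mulsetM.
set x := repr (mkloc a Ss) in e1 *; set y := repr (mkloc b St) in e2 *.
transitivity ((u * (fnum x * s)) * (v * (fnum y * t))); first by ring.
by rewrite e1 e2; ring.
Qed.

Lemma loc_oppE a s (Ss : inS s) : loc_opp (mkloc a Ss) = mkloc (- a) Ss.
Proof.
have [u Su e] := repr_mkloc a Ss; apply/mklocP; exists u => //.
by rewrite !mulNr !mulrN e.
Qed.

Lemma mkloc_eq a s (Ss : inS s) b t (St : inS t) :
  a * t = b * s -> mkloc a Ss = mkloc b St.
Proof. by move=> e; apply/mklocP; exists 1; [exact: mulset1 | rewrite e]. Qed.

Fact loc_addA : associative loc_add.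
Proof.
elim/mkloc_ind => a s Ss; elim/mkloc_ind => b t St; elim/mkloc_ind => c r Sr.
by rewrite !loc_addE; apply: mkloc_eq; ring.
Qed.

Fact loc_addC : commutative loc_add.
Proof.
elim/mkloc_ind => a s Ss; elim/mkloc_ind => b t St.
by rewrite !loc_addE; apply: mkloc_eq; ring.
Qed.

Fact loc_add0 : left_id loc0 loc_add.
Proof. by elim/mkloc_ind => a s Ss; rewrite loc_addE; apply: mkloc_eq; ring. Qed.

Fact loc_addN : left_inverse loc0 loc_opp loc_add.
Proof.
by elim/mkloc_ind => a s Ss; rewrite loc_oppE loc_addE; apply: mkloc_eq; ring.
Qed.

HB.instance Definition _ :=
  GRing.isZmodule.Build localization loc_addA loc_addC loc_add0 loc_addN.

Fact loc_mulA : associative loc_mul.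
Proof.
elim/mkloc_ind => a s Ss; elim/mkloc_ind => b t St; elim/mkloc_ind => c r Sr.
by rewrite !loc_mulE; apply: mkloc_eq; ring.
Qed.

Fact loc_mulC : commutative loc_mul.
Proof.
elim/mkloc_ind => a s Ss; elim/mkloc_ind => b t St.
by rewrite !loc_mulE; apply: mkloc_eq; ring.
Qed.

Fact loc_mul1 : left_id loc1 loc_mul.
Proof. by elim/mkloc_ind => a s Ss; rewrite loc_mulE; apply: mkloc_eq; ring. Qed.

Fact loc_mulDl : left_distributive loc_mul loc_add.
Proof.
elim/mkloc_ind => a s Ss; elim/mkloc_ind => b t St; elim/mkloc_ind => c r Sr.
by rewrite !(loc_addE, loc_mulE); apply: mkloc_eq; ring.
Qed.

HB.instance Definition _ :=
  GRing.Zmodule_isComPzRing.Build localization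
    loc_mulA loc_mulC loc_mul1 loc_mulDl.

End Localization.

Section RingNotions.
Variable R : comPzRingType.

Lemma maximal_compl1 (L : set R) (maxL : maximal_ideal L) : ~ L 1.
Proof.
case: maxL => -[_ _ LM] LT _ L1; apply: LT; apply/seteqP; split=> // x _.
by rewrite -[x]mulr1; exact: LM.
Qed.

Lemma maximal_complM (L : set R) (maxL : maximal_ideal L) (x y : R) :
  ~ L x -> ~ L y -> ~ L (x * y).
Proof.
case: (maxL) => -[L0 LD LM] _ Lmax Lx Ly Lxy.
pose J := [set z | exists a, exists2 l, L l & z = a * x + l].
have JI : is_ideal J.
  split; first by exists 0, 0 => //; rewrite mul0r addr0.
    move=> _ _ [a [l Ll ->]] [b [m Lm ->]].
    by exists (a + b), (l + m); [exact: LD | ring].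
  move=> c _ [a [l Ll ->]]; exists (c * a), (c * l); first exact: LM.
  by ring.
have LJ : L `<=` J by move=> l Ll; exists 0, l => //; rewrite mul0r add0r.
have Jx : J x by exists 1, 0 => //; rewrite mul1r addr0.
case: (Lmax J JI LJ) => [JL|JT]; first by apply: Lx; rewrite -JL.
have [a [l Ll e]] : J 1 by rewrite JT.
apply: Ly; have -> : y = a * (x * y) + y * l.
  by rewrite -[LHS]mul1r e; ring.
by apply: LD; apply: LM.
Qed.

Definition maximal_compl (L : set R) (maxL : maximal_ideal L) : mulSubset R :=
  MulSubset (maximal_compl1 maxL : (~` L) 1) (maximal_complM maxL).

Definition arithmetical : Prop :=
  forall (L : set R) (maxL : maximal_ideal L),
    ideals_totally_ordered (localization (maximal_compl maxL)).

Lemma regular1 : GRing.lreg (1 : R).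
Proof. exact: GRing.lreg1. Qed.

Lemma regularM (x y : R) : GRing.lreg x -> GRing.lreg y -> GRing.lreg (x * y).
Proof. exact: GRing.lregM. Qed.

Definition regular_elements : mulSubset R :=
  @MulSubset R [set s | GRing.lreg s] regular1 regularM.

Definition quotient_ring : comPzRingType := localization regular_elements.

End RingNotions.

Section Modules.
Variable R : pzRingType.

Definition finitely_generated (N : lmodType R) : Prop :=
  exists (n : nat) (g : 'I_n -> N),
    forall y, exists c : 'I_n -> R, y = \sum_(i < n) c i *: g i.

Definition cyclic_module (N : lmodType R) : Prop :=
  exists g : N, forall y, exists a : R, y = a *: g.

Definition linearly_independent (F : lmodType R) (B : set F) : Prop :=
  forall (s : seq F) (c : F -> R), uniq s -> (forall b, b \in s -> B b) ->
    \sum_(b <- s) c b *: b = 0 -> forall b, b \in s -> c b = 0.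

Definition spanning (F : lmodType R) (B : set F) : Prop :=
  forall y : F, exists (s : seq F) (c : F -> R),
    (forall b, b \in s -> B b) /\ y = \sum_(b <- s) c b *: b.

Definition free_module (F : lmodType R) : Prop :=
  exists B : set F, linearly_independent B /\ spanning B.

Definition factors_through_free (N M : lmodType R) (f : {linear N -> M}) : Prop :=
  exists (F : lmodType R) (g : {linear N -> F}) (h : {linear F -> M}),
    free_module F /\ forall x, f x = h (g x).

Definition finitely_projective (M : lmodType R) : Prop :=
  forall (N : lmodType R) (f : {linear N -> M}),
    finitely_generated N -> factors_through_free f.

Definition singly_projective (M : lmodType R) : Prop :=
  forall (N : lmodType R) (f : {linear N -> M}),
    cyclic_module N -> factors_through_free f.

Definition short_exact (A B C : lmodType R)
    (i : {linear A -> B}) (p : {linear B -> C}) : Prop :=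
  [/\ injective i, (forall z, exists y, p y = z) &
      (forall y, p y = 0 <-> exists x, i x = y)].

Definition finitely_presented (N : lmodType R) : Prop :=
  exists (m n : nat) (g : {linear 'rV[R]_m -> 'rV[R]_n})
    (p : {linear 'rV[R]_n -> N}),
    (forall z, exists y, p y = z) /\ (forall y, p y = 0 <-> exists x, g x = y).

Definition pure_exact (A B C : lmodType R)
    (i : {linear A -> B}) (p : {linear B -> C}) : Prop :=
  short_exact i p /\
  forall (N : lmodType R) (f : {linear N -> C}), finitely_presented N ->
    exists g : {linear N -> B}, forall x, p (g x) = f x.

Definition pure_injective (M : lmodType R) : Prop :=
  forall (A B C : lmodType R) (i : {linear A -> B}) (p : {linear B -> C}),
    pure_exact i p -> forall f : {linear A -> M},
    exists g : {linear B -> M}, forall x, g (i x) = f x.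

End Modules.

Definition pure_semisimple (R : pzRingType) : Prop :=
  forall M : lmodType R, pure_injective M.

Section CommutativeModules.
Variable R : comPzRingType.

Definition annihilated (M : lmodType R) (I : set R) : set M :=
  [set m | forall a, I a -> a *: m = 0].

Definition semi_compact (M : lmodType R) : Prop :=
  forall (T : Type) (x_ : T -> M) (I_ : T -> set R),
    (forall t, is_ideal (I_ t)) ->
    (forall K : set T, finite_set K ->
       exists x, forall t, K t -> annihilated (I_ t) (x - x_ t)) ->
    exists x, forall t, annihilated (I_ t) (x - x_ t).

Definition bilinear_map (M N P : lmodType R) (b : M -> N -> P) : Prop :=
  (forall m, linear (b m)) /\ (forall n, linear (b^~ n)).

End CommutativeModules.

(* M (x) N: formal sums of pure tensors, given by lists of pairs (m, n) (signs   *)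
(* and scalars are absorbed in m), two of them being identified when no         *)
(* bilinear map distinguishes them.  Lemma [tensor_universal] shows that this   *)
(* is the tensor product.                                                       *)
Section Tensor.
Variables (R : comPzRingType) (M N : lmodType R).

Definition bilin_sum (P : lmodType R) (b : M -> N -> P) (s : seq (M * N)) : P :=
  \sum_(mn <- s) b mn.1 mn.2.

Definition tensor_rel (s t : seq (M * N)) : bool :=
  `[< forall (P : lmodType R) (b : M -> N -> P), bilinear_map b ->
        bilin_sum b s = bilin_sum b t >].

Lemma tensor_rel_refl : reflexive tensor_rel.
Proof. by move=> s; apply/asboolP. Qed.

Lemma tensor_rel_sym : symmetric tensor_rel.
Proof. by move=> s t; apply/asboolP/asboolP => h P b bb; rewrite h. Qed.

Lemma tensor_rel_trans : transitive tensor_rel.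
Proof.
by move=> t s u /asboolP h1 /asboolP h2; apply/asboolP => P b bb; rewrite h1 ?h2.
Qed.

Canonical tensor_equiv :=
  EquivRel tensor_rel tensor_rel_refl tensor_rel_sym tensor_rel_trans.

Definition tensor := {eq_quot tensor_rel}.
HB.instance Definition _ : EqQuotient _ tensor_rel tensor := EqQuotient.on tensor.
HB.instance Definition _ := Choice.on tensor.

Definition tsum (s : seq (M * N)) : tensor := \pi_tensor s.

Definition tlift (P : lmodType R) (b : M -> N -> P) (x : tensor) : P :=
  bilin_sum b (repr x).

Lemma tlift_tsum (P : lmodType R) (b : M -> N -> P) s : bilinear_map b ->
  tlift b (tsum s) = bilin_sum b s.
Proof.
move=> bb; have /eqmodP/asboolP/(_ P b bb) // : repr (tsum s) = s %[mod tensor].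
by rewrite reprK.
Qed.

Lemma tensorP (x y : tensor) :
  (forall (P : lmodType R) (b : M -> N -> P), bilinear_map b ->
     tlift b x = tlift b y) -> x = y.
Proof.
by move=> h; rewrite -[x]reprK -[y]reprK; apply/eqmodP/asboolP => P b /h.
Qed.

Definition tadd (x y : tensor) : tensor := tsum (repr x ++ repr y).
Definition tscale (a : R) (x : tensor) : tensor :=
  tsum [seq (a *: mn.1, mn.2) | mn <- repr x].
Definition topp (x : tensor) : tensor := tscale (-1) x.
Definition tzero : tensor := tsum [::].

Lemma tlift_add (P : lmodType R) (b : M -> N -> P) x y : bilinear_map b ->
  tlift b (tadd x y) = tlift b x + tlift b y.
Proof. by move=> bb; rewrite tlift_tsum // /bilin_sum big_cat. Qed.

Lemma tlift_scale (P : lmodType R) (b : M -> N -> P) a x : bilinear_map b ->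
  tlift b (tscale a x) = a *: tlift b x.
Proof.
move=> bb; rewrite tlift_tsum // /tlift /bilin_sum big_map scaler_sumr.
apply: eq_bigr => -[m n] _ /=; have [_ lb] := bb.
have b0 : b 0 n = 0.
  have := lb n 1 0 0; rewrite !scale1r addr0 => e.
  by apply: (addrI (b 0 n)); rewrite -e addr0.
by have := lb n a m 0; rewrite /= b0 !addr0.
Qed.

Lemma tlift_zero (P : lmodType R) (b : M -> N -> P) : bilinear_map b ->
  tlift b tzero = 0.
Proof. by move=> bb; rewrite tlift_tsum // /bilin_sum big_nil. Qed.

Fact taddA : associative tadd.
Proof. by move=> x y z; apply: tensorP => P b bb; rewrite !tlift_add // addrA. Qed.

Fact taddC : commutative tadd.
Proof. by move=> x y; apply: tensorP => P b bb; rewrite !tlift_add // addrC. Qed.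

Fact tadd0 : left_id tzero tadd.
Proof.
by move=> x; apply: tensorP => P b bb; rewrite tlift_add // tlift_zero // add0r.
Qed.

Fact taddN : left_inverse tzero topp tadd.
Proof.
move=> x; apply: tensorP => P b bb.
by rewrite tlift_add // tlift_scale // tlift_zero // scaleN1r addNr.
Qed.

HB.instance Definition _ :=
  GRing.isZmodule.Build tensor taddA taddC tadd0 taddN.

Fact tscaleA a b x : tscale a (tscale b x) = tscale (a * b) x.
Proof. by apply: tensorP => P f ff; rewrite !tlift_scale // scalerA. Qed.

Fact tscale1 : left_id 1 tscale.
Proof. by move=> x; apply: tensorP => P f ff; rewrite tlift_scale // scale1r. Qed.

Fact tscaleDr : right_distributive tscale +%R.
Proof.
move=> a x y; apply: tensorP => P f ff.
by rewrite !(tlift_scale, tlift_add) // scalerDr.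
Qed.

Fact tscaleDl x : {morph tscale^~ x : a b / a + b}.
Proof.
move=> a b; apply: tensorP => P f ff.
by rewrite !(tlift_scale, tlift_add) // scalerDl.
Qed.

HB.instance Definition _ :=
  GRing.Zmodule_isLmodule.Build R tensor tscaleA tscale1 tscaleDr tscaleDl.

Definition tpure (m : M) (n : N) : tensor := tsum [:: (m, n)].

Lemma tlift_tpure (P : lmodType R) (b : M -> N -> P) m n : bilinear_map b ->
  tlift b (tpure m n) = b m n.
Proof. by move=> bb; rewrite tlift_tsum // /bilin_sum big_seq1. Qed.

Lemma tlift_linear (P : lmodType R) (b : M -> N -> P) : bilinear_map b ->
  linear (tlift b).
Proof.
move=> bb a x y; rewrite [LHS](tlift_add (a *: x) y bb).
by rewrite [tlift b (a *: x)](tlift_scale a x bb).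
Qed.

Lemma tpure_bilinear : bilinear_map tpure.
Proof.
split=> [m|n] a u v; apply: tensorP => P b bb;
  rewrite tlift_linear // !tlift_tpure //;
  case: bb => b1 b2; [exact: b1 | exact: (b2 n)].
Qed.

Lemma tsumE s : tsum s = \sum_(mn <- s) tpure mn.1 mn.2.
Proof.
apply: tensorP => P b bb; rewrite tlift_tsum // /bilin_sum.
elim: s => [|mn s IHs]; first by rewrite !big_nil [RHS]tlift_zero.
by rewrite !big_cons [RHS]tlift_add // -IHs tlift_tpure.
Qed.

Lemma tensor_universal (P : lmodType R) (b : M -> N -> P) : bilinear_map b ->
  exists! h : tensor -> P, linear h /\ forall m n, h (tpure m n) = b m n.
Proof.
move=> bb; exists (tlift b); split.
  by split=> [|m n]; [exact: tlift_linear | exact: tlift_tpure].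
move=> h [lh hE]; apply/funext => x; rewrite -[x]reprK -[\pi_ _ _]/(tsum _) tlift_tsum //.
pose hL : {linear tensor -> P} :=
  HB.pack h (GRing.isLinear.Build R tensor P *:%R h lh).
rewrite -[h _]/(hL _) tsumE linear_sum; apply: eq_bigr => mn _.
by rewrite -hE.
Qed.

End Tensor.

Section Flat.
Variable R : comPzRingType.

Definition tensor_map (M A B : lmodType R) (f : A -> B) :
    tensor M A -> tensor M B :=
  tlift (fun m a => tpure m (f a)).

Definition flat (M : lmodType R) : Prop :=
  forall (A B : lmodType R) (f : {linear A -> B}),
    injective f -> injective (tensor_map (M := M) f).

End Flat.

(* Main.v *)
Require Import Defs.
From HB Require Import structures.
From mathcomp Require Import all_boot all_order all_algebra.
From mathcomp Require Import generic_quotient ring zify.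
From mathcomp Require Import boolp classical_sets functions cardinality.

(** Two finiteness conditions link the statements.  The first one,
    [ann_chain_condition], asks that a sequence of elements of [R], each a
    multiple of the preceding one, has a stationary step in its sequence of
    annihilators.  The second one says that finitely generated modules over the
    quotient ring [Q] are noetherian.

    From modules to chains.  If all flat modules are singly projective, then so
    is the Bass module, the colimit of [R -> R -> R -> ...] along
    multiplications; factoring the inclusion of the submodule generated by its
    first generator through a free module yields the chain condition
    ([singly_projective_ann_chain]).  If all flat modules are semi-compact, the
    free module on countably many generators already yields it
    ([semi_compact_ann_chain]): a system of congruences whose partial solutions
    have growing supports must have a solution with finite support.

    From chains to pure-semisimplicity.  The chain condition passes to [Q], and
    so does the elementwise form of arithmeticity, [locally_comparable].  Every
    non-zero-divisor of [Q] is invertible, and together these facts give each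
    element a Fitting decomposition ([fitting_idempotent]).  Hence, for a
    primitive idempotent [e], the ring [e Q] is a chain ring whose maximal ideal
    is nilpotent and principal ([primitive_uniserial]).  Over such a ring an
    element of maximal order modulo a pure submodule can be corrected by that
    submodule so as to have the same order itself; by Zorn's lemma, maps extend
    from pure submodules ([uniserial_extension]).  The chain condition is also
    well-foundedness of divisibility on idempotents, so the extensions on the
    primitive parts add up to one on the whole module
    ([idempotent_extension]).

    From pure-semisimplicity to modules.  For an ascending sequence of
    submodules [U k] of a finitely generated module [V], the direct sum of the
    [V / U k] is pure in their product, hence a direct summand, and this forces
    the sequence to have a stationary step ([pure_semisimple_dependent]).  Regular
    elements act injectively on flat modules, so that for flat modules every
    family of congruences, or of relations between finitely many elements,
    reduces to a finite one.  Finitely many congruences are solvable by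
    assumption ([flat_semi_compact]), and finitely many relations can be
    resolved through a free module by flatness ([flat_relations],
    [flat_finitely_projective]). *)

Set Implicit Arguments.
Unset Strict Implicit.
Unset Printing Implicit Defensive.

Import GRing.Theory.
Local Open Scope ring_scope.
Local Open Scope quotient_scope.
Local Open Scope classical_set_scope.

(** * Submodules, quotient modules and linear maps *)

Definition is_submodule (R : pzRingType) (V : lmodType R) (U : set V) : Prop :=
  [/\ U 0, forall x y, U x -> U y -> U (x + y) & forall a x, U x -> U (a *: x)].

Record submodule (R : pzRingType) (V : lmodType R) := Submodule {
  subset_of :> V -> Prop;
  submoduleP : is_submodule subset_of }.

Section SubmoduleTheory.
Variables (R : pzRingType) (V : lmodType R) (U : submodule V).

Lemma sm0 : U 0. Proof. by case: (submoduleP U). Qed.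

Lemma smD x y : U x -> U y -> U (x + y).
Proof. by case: (submoduleP U) => _ h _; exact: h. Qed.

Lemma smZ a x : U x -> U (a *: x).
Proof. by case: (submoduleP U) => _ _; exact. Qed.

Lemma smN x : U x -> U (- x).
Proof. by rewrite -scaleN1r; exact: smZ. Qed.

Lemma smB x y : U x -> U y -> U (x - y).
Proof. by move=> Ux Uy; apply: smD => //; exact: smN. Qed.

Lemma sm_sum (I : Type) (r : seq I) (P : pred I) (F : I -> V) :
  (forall i, P i -> U (F i)) -> U (\sum_(i <- r | P i) F i).
Proof.
move=> h; elim/big_ind: _ => //; first exact: sm0.
by move=> x y; exact: smD.
Qed.

Lemma smBK x y : U (x - y) -> U y -> U x.
Proof. by move=> Uxy Uy; rewrite -(subrK y x); exact: smD. Qed.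

End SubmoduleTheory.

Lemma exists_linear (R : pzRingType) (V W : lmodType R) (f : V -> W) :
  linear f -> exists g : {linear V -> W}, forall x, g x = f x.
Proof.
move=> lf.
by exists (HB.pack f (GRing.isLinear.Build R V W *:%R f lf) : {linear V -> W}).
Qed.

Section Submod.
Variables (R : pzRingType) (V : lmodType R) (U : submodule V).

Definition in_submod : pred V := fun x => `[< U x >].

Fact in_submod_closed : subsemimod_closed in_submod.
Proof.
split; first split.
- by apply/asboolP; exact: sm0.
- by move=> x y /asboolP Ux /asboolP Uy; apply/asboolP; exact: smD.
by move=> a x /asboolP Ux; apply/asboolP; exact: smZ.
Qed.

HB.instance Definition _ := GRing.isSubmodClosed.Build R V in_submod in_submod_closed.

Definition submod : Type := {x : V | in_submod x}.
HB.instance Definition _ := SubChoice.on submod.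
HB.instance Definition _ := [SubChoice_isSubLmodule of submod by <:].

Definition submod_val : submod -> V := val.

Fact submod_val_linear : linear submod_val.
Proof. by []. Qed.
HB.instance Definition _ :=
  GRing.isLinear.Build R submod V *:%R submod_val submod_val_linear.

Lemma submod_val_inj : injective submod_val. Proof. exact: val_inj. Qed.

Lemma submodP (x : submod) : U (submod_val x).
Proof. exact: asboolW (valP x). Qed.

Definition to_submod x (Ux : U x) : submod := exist _ x (asboolT Ux).

End Submod.

Section Quotmod.
Variables (R : pzRingType) (V : lmodType R) (U : submodule V).

Definition quot_rel (x y : V) : bool := `[< U (x - y) >].

Fact quot_rel_refl : reflexive quot_rel.
Proof. by move=> x; apply/asboolP; rewrite subrr; exact: sm0. Qed.

Fact quot_rel_sym : symmetric quot_rel.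
Proof. by move=> x y; apply/asboolP/asboolP => /smN; rewrite opprB. Qed.

Fact quot_rel_trans : transitive quot_rel.
Proof.
move=> y x z /asboolP h /asboolP k; apply/asboolP.
by rewrite -(subrK y x) -addrA; exact: smD.
Qed.

Canonical quot_equiv := EquivRel quot_rel quot_rel_refl quot_rel_sym quot_rel_trans.

Definition quotmod := {eq_quot quot_rel}.
HB.instance Definition _ : EqQuotient _ quot_rel quotmod := EqQuotient.on quotmod.
HB.instance Definition _ := Choice.on quotmod.

Definition cls (x : V) : quotmod := \pi_quotmod x.

Lemma clsP x y : cls x = cls y <-> U (x - y).
Proof. by split=> [/eqmodP/asboolP|h] //; apply/eqmodP/asboolP. Qed.

Lemma cls_surj (q : quotmod) : exists x, cls x = q.
Proof. by exists (repr q); exact: reprK. Qed.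

Lemma cls_repr x : U (repr (cls x) - x).
Proof. by apply/clsP; exact: reprK. Qed.

Definition quot_add (p q : quotmod) := cls (repr p + repr q).
Definition quot_opp (p : quotmod) := cls (- repr p).
Definition quot_scale (a : R) (p : quotmod) := cls (a *: repr p).

Lemma quot_addE x y : quot_add (cls x) (cls y) = cls (x + y).
Proof.
by apply/clsP; rewrite opprD addrACA; apply: smD; exact: cls_repr.
Qed.

Lemma quot_oppE x : quot_opp (cls x) = cls (- x).
Proof. by apply/clsP; rewrite -opprD; apply: smN; exact: cls_repr. Qed.

Lemma quot_scaleE a x : quot_scale a (cls x) = cls (a *: x).
Proof. by apply/clsP; rewrite -scalerBr; apply: smZ; exact: cls_repr. Qed.

Lemma quotmod_ind (P : quotmod -> Prop) : (forall x, P (cls x)) -> forall q, P q.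
Proof. by move=> h q; have [x <-] := cls_surj q. Qed.

Fact quot_addA : associative quot_add.
Proof.
elim/quotmod_ind => x; elim/quotmod_ind => y; elim/quotmod_ind => z.
by rewrite !quot_addE addrA.
Qed.

Fact quot_addC : commutative quot_add.
Proof.
by elim/quotmod_ind => x; elim/quotmod_ind => y; rewrite !quot_addE addrC.
Qed.

Fact quot_add0 : left_id (cls 0) quot_add.
Proof. by elim/quotmod_ind => x; rewrite quot_addE add0r. Qed.

Fact quot_addN : left_inverse (cls 0) quot_opp quot_add.
Proof. by elim/quotmod_ind => x; rewrite quot_oppE quot_addE addNr. Qed.

HB.instance Definition _ :=
  GRing.isZmodule.Build quotmod quot_addA quot_addC quot_add0 quot_addN.

Fact quot_scaleA a b p : quot_scale a (quot_scale b p) = quot_scale (a * b) p.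
Proof. by elim/quotmod_ind: p => x; rewrite !quot_scaleE scalerA. Qed.

Fact quot_scale1 : left_id 1 quot_scale.
Proof. by elim/quotmod_ind => x; rewrite quot_scaleE scale1r. Qed.

Fact quot_scaleDr : right_distributive quot_scale +%R.
Proof.
move=> a; elim/quotmod_ind => x; elim/quotmod_ind => y.
by rewrite [cls x + _]quot_addE !quot_scaleE [RHS]quot_addE scalerDr.
Qed.

Fact quot_scaleDl p : {morph quot_scale^~ p : a b / a + b}.
Proof.
move=> a b; elim/quotmod_ind: p => x.
by rewrite !quot_scaleE [RHS]quot_addE scalerDl.
Qed.

HB.instance Definition _ := GRing.Zmodule_isLmodule.Build R quotmod
  quot_scaleA quot_scale1 quot_scaleDr quot_scaleDl.

Fact cls_linear : linear cls.
Proof.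
move=> a x y; have -> : a *: cls x = cls (a *: x) := quot_scaleE a x.
by rewrite [RHS]quot_addE.
Qed.
HB.instance Definition _ := GRing.isLinear.Build R V quotmod *:%R cls cls_linear.

Lemma cls0P x : cls x = 0 <-> U x.
Proof. by rewrite -(linear0 cls) clsP subr0. Qed.

End Quotmod.

(** A surjective linear map is the cokernel of its kernel. *)
Lemma linear_factor (R : pzRingType) (V W X : lmodType R)
    (p : {linear V -> W}) (h : {linear V -> X}) :
  (forall w, exists v, p v = w) -> (forall v, p v = 0 -> h v = 0) ->
  exists k : {linear W -> X}, forall v, k (p v) = h v.
Proof.
move=> psurj ker; have [s sK] := choice psurj.
have hs v w : p v = w -> h (s w) = h v.
  move=> pv; apply/eqP; rewrite -subr_eq0 -linearB; apply/eqP/ker.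
  by rewrite linearB sK pv subrr.
have [|k kE] := @exists_linear R W X (fun w => h (s w)).
  by move=> a x y; rewrite -linearP; apply: hs; rewrite linearP !sK.
by exists k => v; rewrite kE; exact: hs.
Qed.

Section RowVectors.
Variables (R : pzRingType) (n : nat).
Local Notation unitv := (fun i : 'I_n => delta_mx 0 i : 'rV[R]_n).

Lemma row_linear_sum (M : lmodType R) (h : {linear 'rV[R]_n -> M}) v :
  h v = \sum_i v 0 i *: h (unitv i).
Proof.
by rewrite {1}[v]row_sum_delta linear_sum; apply: eq_bigr => i _; rewrite linearZ_LR.
Qed.

Lemma exists_row_linear (M : lmodType R) (m : 'I_n -> M) :
  exists h : {linear 'rV[R]_n -> M}, forall v, h v = \sum_i v 0 i *: m i.
Proof.
apply: exists_linear => a u v; rewrite scaler_sumr -big_split /=.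
by apply: eq_bigr => i _; rewrite !mxE scalerDl scalerA.
Qed.

End RowVectors.

(** * Pure-semisimple rings are noetherian *)

Definition eventually (P : nat -> Prop) : Prop := exists N, forall k, (N <= k)%N -> P k.

Lemma eventuallyT (P : nat -> Prop) : (forall k, P k) -> eventually P.
Proof. by move=> h; exists 0%N. Qed.

Lemma eventually_and (P P' : nat -> Prop) :
  eventually P -> eventually P' -> eventually (fun k => P k /\ P' k).
Proof.
move=> [N hN] [N' hN']; exists (N + N')%N => k le_k.
by split; [apply: hN | apply: hN']; lia.
Qed.

Lemma eventually_mono (P P' : nat -> Prop) :
  (forall k, P k -> P' k) -> eventually P -> eventually P'.
Proof. by move=> h [N hN]; exists N => k /hN /h. Qed.

Lemma eventually_all (I : finType) (P : I -> nat -> Prop) :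
  (forall i, eventually (P i)) -> eventually (fun k => forall i, P i k).
Proof.
move=> /choice[N hN]; exists (\max_i N i)%N => k le_k i; apply: hN.
exact: leq_trans (leq_bigmax i) le_k.
Qed.

Lemma fct_lin_sumE (R : pzRingType) (V : lmodType R) (I : Type) (r : seq I)
    (T : Type) (a : I -> R) (f : I -> T -> V) (k : T) :
  (\sum_(i <- r) a i *: f i) k = \sum_(i <- r) a i *: f i k.
Proof. by rewrite fct_sumE. Qed.

Section SequenceSubmodules.
Variables (R : pzRingType) (V : lmodType R) (U : nat -> submodule V).

Fact seq_in_is_submodule : is_submodule [set x : nat -> V | forall k, U k (x k)].
Proof.
split=> [k|x y Ux Uy k|a x Ux k]; [exact: sm0|exact: smD|exact: smZ].
Qed.
Definition seq_in := Submodule seq_in_is_submodule.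

Fact seq_ev_in_is_submodule :
  is_submodule [set x : nat -> V | eventually (fun k => U k (x k))].
Proof.
split=> [|x y Ux Uy|a x Ux].
- by apply: eventuallyT => k; exact: sm0.
- by apply: eventually_mono (eventually_and Ux Uy) => k [? ?]; exact: smD.
by apply: eventually_mono Ux => k; exact: smZ.
Qed.
Definition seq_ev_in := Submodule seq_ev_in_is_submodule.

End SequenceSubmodules.

Fact ker_is_submodule (R : pzRingType) (V W : lmodType R) (q : {linear V -> W}) :
  is_submodule [set x | q x = 0].
Proof.
split=> [|x y /= qx qy|a x /= qx]; first exact: linear0.
  by rewrite linearD qx qy addr0.
by rewrite linearZ_LR qx scaler0.
Qed.
Definition ker_submodule (R : pzRingType) (V W : lmodType R) (q : {linear V -> W}) :=
  Submodule (ker_is_submodule q).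

(** Finitely many relations between sequences that hold modulo [U] eventually
    hold everywhere once the sequences are replaced by zero up to some index;
    hence the direct sum of the [V / U k] is pure in their product. *)
Lemma sum_pure_in_product (R : pzRingType) (V : lmodType R) (U : nat -> submodule V)
    (q : {linear quotmod (seq_in U) -> quotmod (seq_ev_in U)}) :
  (forall x, q (cls _ x) = cls _ x) ->
  pure_exact (@submod_val _ _ (ker_submodule q)) q.
Proof.
move=> qE; split.
  split=> [|z|y]; first exact: submod_val_inj.
  - by have [x <-] := cls_surj z; exists (cls _ x).
  split=> [qy|[x <-]]; last exact: (submodP x).
  by exists (@to_submod _ _ (ker_submodule q) y qy).
move=> N f [m [n [g [p [psurj kerp]]]]].
have [b bE] := choice (fun i : 'I_n => cls_surj (f (p (delta_mx 0 i)))).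
have fpE w : f (p w) = cls _ (\sum_i w 0 i *: b i).
  rewrite (row_linear_sum p) !linear_sum; apply: eq_bigr => i _.
  by rewrite !linearZ_LR -bE.
pose w j := g (delta_mx 0 j).
have [n0 hn0] : eventually (fun k => forall j, U k (\sum_i w j 0 i *: b i k)).
  apply: eventually_all => j.
  have /cls0P : cls (seq_ev_in U) (\sum_i w j 0 i *: b i) = 0.
    by rewrite -fpE (_ : p _ = 0) ?linear0 //; apply/kerp; exists (delta_mx 0 j).
  by apply: eventually_mono => k; rewrite fct_lin_sumE.
pose b' i k := if (n0 <= k)%N then b i k else 0.
have [h hE] := exists_row_linear (fun i => cls (seq_in U) (b' i)).
have hgj j : h (w j) = 0.
  rewrite hE (_ : \sum_i _ = cls (seq_in U) (\sum_i w j 0 i *: b' i)).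
    apply/cls0P => k; rewrite fct_lin_sumE /b'.
    case: leqP => [/hn0//|_]; rewrite big1 => [|i _]; first exact: sm0.
    by rewrite scaler0.
  by rewrite linear_sum; apply: eq_bigr => i _; rewrite linearZ_LR.
have [k kE] : exists k : {linear N -> quotmod (seq_in U)}, forall v, k (p v) = h v.
  apply: linear_factor => // v /kerp[u <-].
  rewrite (row_linear_sum g) linear_sum big1 // => j _.
  by rewrite linearZ_LR hgj scaler0.
exists k => x; have [v <-] := psurj x; rewrite kE hE linear_sum fpE.
under eq_bigr => i _ do rewrite linearZ_LR qE -linearZ_LR.
rewrite -linear_sum; apply/clsP; exists n0 => j le_j.
have -> : forall y z : nat -> V, (y - z) j = y j - z j by [].
rewrite !fct_lin_sumE -sumrB big1 => [|i _]; first exact: sm0.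
by rewrite /b' le_j subrr.
Qed.

Section Span.
Variables (R : pzRingType) (V : lmodType R) (v : nat -> V).

Fact prefix_span_is_submodule k :
  is_submodule [set x | exists c : nat -> R, x = \sum_(i < k) c i *: v i].
Proof.
split=> [|x y [c ->] [d ->]|a x [c ->]].
- by exists (fun=> 0); rewrite big1 // => i _; rewrite scale0r.
- exists (fun i => c i + d i); rewrite -big_split; apply: eq_bigr => i _.
  by rewrite scalerDl.
exists (fun i => a * c i); rewrite scaler_sumr; apply: eq_bigr => i _.
by rewrite scalerA.
Qed.
Definition prefix_span k := Submodule (prefix_span_is_submodule k).

Lemma prefix_span_mem k i : (i < k)%N -> prefix_span k (v i).
Proof.
move=> lt_ik; exists (fun j => if j == i then 1 else 0).
rewrite (bigD1 (Ordinal lt_ik)) //= eqxx scale1r big1 ?addr0 // => j.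
by rewrite -val_eqE /= => /negPf ->; rewrite scale0r.
Qed.

End Span.

(** Let [U k] be the span of [v 0], ..., [v (k-1)].  A retraction of the product
    of the [V / U k] onto their direct sum sends every constant sequence to a
    sequence vanishing from some index [m] on, the same for all of [V] because
    [V] is finitely generated.  The constant sequence [v m] coincides modulo [U]
    with its head of length [m + 1], which the retraction fixes; so [v m] is zero
    modulo [U m]. *)
Lemma pure_semisimple_dependent (R : pzRingType) (V : lmodType R) (v : nat -> V) :
  pure_semisimple R -> finitely_generated V ->
  exists m (c : nat -> R), v m = \sum_(i < m) c i *: v i.
Proof.
move=> pssR [n [g gen]]; pose U := prefix_span v.
have [q qE] : exists q : {linear quotmod (seq_in U) -> quotmod (seq_ev_in U)},
    forall x, q (cls _ x) = cls _ x.
  apply: linear_factor => [w|x /cls0P Ux]; first exact: cls_surj.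
  by apply/cls0P; exact: eventuallyT.
have [r rE] := pssR _ _ _ _ _ _ (sum_pure_in_product qE) idfun.
pose rho := @submod_val _ _ (ker_submodule q) \o r.
have rho_ker y : q y = 0 -> rho y = y.
  by move=> qy; rewrite /rho /= (rE (@to_submod _ _ (ker_submodule q) y qy)).
have q_rho y : q (rho y) = 0 by exact: submodP (r y).
have [x xE] := choice (fun j => cls_surj (rho (cls _ (fun=> g j)))).
have [m hm] : eventually (fun k => forall j, U k (x j k)).
  apply: eventually_all => j.
  suff /cls0P : cls (seq_ev_in U) (x j) = 0 by [].
  by rewrite -qE xE.
exists m; suff : U m (v m) by [].
have [c vmE] := gen (v m).
pose head k := if (k <= m)%N then v m else 0.
have constE : cls (seq_in U) (fun=> v m) = cls _ head.
  apply/clsP => k; rewrite /head /GRing.add /GRing.opp /=.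
  case: leqP => [_|lt_mk]; first by rewrite subrr; exact: (sm0 (U k)).
  by rewrite subr0; exact: prefix_span_mem.
have headE : rho (cls _ head) = cls _ head.
  apply: rho_ker; rewrite qE; apply/cls0P; exists m.+1 => k.
  by rewrite /head ltnNge => /negPf->; exact: (sm0 (U k)).
have /clsP/(_ m) : cls (seq_in U) head = cls _ (\sum_j c j *: x j).
  rewrite -headE -constE linear_sum.
  have -> : (fun=> v m) = \sum_j c j *: (fun=> g j) :> (nat -> V).
    by apply/funext => k; rewrite fct_lin_sumE vmE.
  rewrite (linear_sum (cls _)) /rho (linear_sum (@submod_val _ _ _ \o r)).
  by apply: eq_bigr => j _; rewrite !linearZ_LR; congr (_ *: _); exact/esym/xE.
have -> : forall y z : nat -> V, (y - z) m = y m - z m by [].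
rewrite /head leqnn fct_lin_sumE => /smBK; apply.
by apply: sm_sum => j _; exact/smZ/hm.
Qed.

(** * Extending linear maps from pure submodules *)

Lemma Zorn_nonempty_chains (T : Type) (P : set (set T)) (X0 : set T) :
  P X0 ->
  (forall F : set (set T), F `<=` P -> total_on F subset -> F !=set0 ->
     P (\bigcup_(X in F) X)) ->
  exists2 A, P A & forall B, P B -> A `<=` B -> B `<=` A.
Proof.
move=> PX0 chainP.
have [|A [PA maxA]] := @Zorn_bigcup T [set X | X = set0 \/ P X].
  move=> F PF totF.
  have [FP0|FP0] := pselect (F `&` P !=set0).
    right; have -> : \bigcup_(X in F) X = \bigcup_(X in F `&` P) X.
      apply/seteqP; split=> x [X FX Xx]; last by exists X => //; case: FX.
      by exists X => //; split=> //; have [X0'|//] := PF X FX; rewrite X0' in Xx.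
    by apply: chainP => // X Y [FX _] [FY _]; exact: totF.
  left; apply/seteqP; split=> // x [X FX Xx].
  have [X0'|PX] := PF X FX; first by rewrite X0' in Xx.
  by case: FP0; exists X.
have maxA' B : P B -> A `<=` B -> B `<=` A.
  move=> PB AB; apply: contrapT => BA; apply: (maxA B); last by right.
  by split.
case: PA => [A0|PA]; last by exists A.
rewrite A0 in maxA'; have X0E : X0 = set0.
  by apply/seteqP; split=> //; exact: maxA'.
by exists A; rewrite ?A0 // -X0E.
Qed.

(** Purity makes [B -> C] lift the map from the cyclic module [Q / r Q] that
    picks an element of [C] killed by [r]. *)
Lemma pure_divisible (Q : comPzRingType) (A B C : lmodType Q)
    (i : {linear A -> B}) (p : {linear B -> C}) :
  pure_exact i p ->
  forall r a b, i a = r *: b -> exists a', a = r *: a'.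
Proof.
move=> [[inji surjp kerp] lift] r a b iaE.
have Us : is_submodule [set v : 'rV[Q]_1 | exists w, v = r *: w].
  split=> [|_ _ [v ->] [w ->]|c _ [v ->]]; first by exists 0; rewrite scaler0.
    by exists (v + w); rewrite scalerDr.
  by exists (c *: v); rewrite !scalerA mulrC.
pose U := Submodule Us; pose one := delta_mx 0 0 : 'rV[Q]_1.
have [h0 h0E] := exists_row_linear (fun _ : 'I_1 => p b).
have [h hE] : exists h : {linear quotmod U -> C}, forall v, h (cls U v) = h0 v.
  apply: linear_factor => [|v /cls0P[w ->]]; first exact: cls_surj.
  rewrite linearZ_LR h0E big_ord1 scalerA mulrC -scalerA -linearZ_LR -iaE.
  have /kerp pia : exists x, i x = i a by exists a.
  by rewrite pia scaler0.
have [|g gE] := lift (quotmod U) h.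
  have [s sE] : exists s : {linear 'rV[Q]_1 -> 'rV[Q]_1}, forall v, s v = r *: v.
    by apply: exists_linear => c v w; rewrite scalerDr !scalerA mulrC.
  exists 1%N, 1%N, s, (cls U); split=> [z|v]; first exact: cls_surj.
  rewrite cls0P; split=> -[w]; first by move=> ->; exists w; rewrite sE.
  by move=> <-; exists w; rewrite sE.
pose b1 := g (cls U one).
have rb1 : r *: b1 = 0.
  have rone : r *: cls U one = 0.
    by rewrite -linearZ_LR; apply/cls0P; exists one.
  by rewrite -linearZ_LR rone linear0.
have /kerp[a' ia'] : p (b - b1) = 0.
  by rewrite linearB /= gE hE h0E big_ord1 mxE !eqxx scale1r subrr.
exists a'; apply: inji; rewrite iaE linearZ_LR ia' scalerBr rb1.
by rewrite subr0.
Qed.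

(** For [e <> 0] this makes [e Q] an artinian chain ring with maximal ideal
    generated by [e p]; the factors [w], [w'] replace a unit. *)
Definition uniserial_idempotent (Q : comPzRingType) (e p : Q) (n : nat) : Prop :=
  [/\ e * e = e, e * p ^+ n = 0 &
      forall r, exists j w w', e * r = e * (w * p ^+ j) /\ e * p ^+ j = e * (w' * r)].

Section UniserialExtension.
Variables (Q : comPzRingType) (e p : Q) (n : nat).
Hypothesis eP : uniserial_idempotent e p n.
Variables (A B M : lmodType Q) (i : {linear A -> B}) (f : {linear A -> M}).

(** Partial linear maps are encoded by their graphs, so that a chain of them has
    its union as an upper bound.  The last condition is purity of the domain,
    restricted to the multipliers that matter for a uniserial idempotent. *)
Definition partial_extension (G : set (B * M)) : Prop :=
  [/\ is_submodule (V := (B * M)%type) G,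
      forall m, G (0, m) -> m = 0,
      forall a, G (i a, f (e *: a)) &
      forall j b m, G (e * p ^+ j *: b, m) ->
        exists d m', G (d, m') /\ e * p ^+ j *: b = e * p ^+ j *: d].

Definition graph_dom (G : set (B * M)) : set B := [set b | exists m, G (b, m)].

Lemma graph_dom_is_submodule G : partial_extension G -> is_submodule (graph_dom G).
Proof.
case=> -[G0 GD GZ] _ _ _; split=> [|x y [m Gx] [m' Gy]|a x [m Gx]].
- by exists 0.
- by exists (m + m'); exact: (GD _ _ Gx Gy).
by exists (a *: m); exact: (GZ a _ Gx).
Qed.

Lemma partial_extension_bigcup (F : set (set (B * M))) :
  F `<=` partial_extension -> total_on F subset -> F !=set0 ->
  partial_extension (\bigcup_(X in F) X).
Proof.
move=> PF totF [X0 FX0]; split; first split.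
- by exists X0 => //; have [[]] := PF X0 FX0.
- move=> x y [X FX Xx] [Y FY Yy]; have [XY|YX] := totF X Y FX FY.
    by exists Y => //; have [[_ YD _] _ _ _] := PF Y FY; apply: YD => //; exact: XY.
  by exists X => //; have [[_ XD _] _ _ _] := PF X FX; apply: XD => //; exact: YX.
- by move=> a x [X FX Xx]; exists X => //; have [[_ _ XZ] _ _ _] := PF X FX; exact: XZ.
- by move=> m [X FX X0m]; have [_ X0' _ _] := PF X FX; exact: X0'.
- by move=> a; exists X0 => //; have [_ _ X0i _] := PF X0 FX0; exact: X0i.
move=> j b m [X FX Xb]; have [_ _ _ /(_ j b m Xb)[d [m' [Xd ->]]]] := PF X FX.
by exists d, m'; split=> //; exists X.
Qed.

(** The element [b] has the same order [p ^+ k.+1] as its class modulo the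
    domain, so the submodule it generates meets the domain trivially and the map
    extends by zero.  No class modulo the domain has a larger order, which makes
    the submodule generated by the class of [b] pure, and the new domain with
    it. *)
Lemma partial_extension_step (G : set (B * M)) k b :
  partial_extension G -> e *: b = b -> p ^+ k.+1 *: b = 0 ->
  ~ graph_dom G (p ^+ k *: b) ->
  (forall y, graph_dom G (e * p ^+ k.+1 *: y)) ->
  partial_extension [set x | exists c, G (x.1 - c *: b, x.2)].
Proof.
move=> PG eb pb Db Dk; have [[G0 GD GZ] Gfun Gi Gpure] := PG.
pose D := Submodule (graph_dom_is_submodule PG).
have [ee _ assoc] := eP.
(* a multiple c b is p^j b up to a factor that is a unit on e Q *)
have cbP c : exists j w, [/\ c *: b = w * p ^+ j *: b, D (c *: b) -> (k < j)%N &
    forall t, D (t * c *: b) -> D (t * p ^+ j *: b)].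
  have [j [w [w' [ecE epE]]]] := assoc c.
  have cbE : c *: b = w * p ^+ j *: b.
    by rewrite -eb !scalerA [c * e]mulrC ecE; congr (_ *: _); ring.
  have pjE : p ^+ j *: b = w' * c *: b.
    by rewrite -eb !scalerA [_ * e]mulrC epE; congr (_ *: _); ring.
  have Dt t : D (t * c *: b) -> D (t * p ^+ j *: b).
    have -> : t * p ^+ j *: b = w' *: (t * c *: b).
      by rewrite -[LHS]scalerA pjE !scalerA; congr (_ *: _); ring.
    exact: (smZ (U := D)).
  exists j, w; split=> // Dcb; rewrite ltnNge; apply/negP => le_jk; apply: Db.
  have /Dt : D (1 * c *: b) by rewrite mul1r.
  by rewrite mul1r -(subnK le_jk) exprD -scalerA => ?; exact: (smZ (U := D)).
have pb_big j : (k < j)%N -> p ^+ j *: b = 0.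
  by move=> lt_kj; rewrite -(subnK lt_kj) exprD -scalerA pb scaler0.
split; first split.
- by exists 0; rewrite scale0r subr0.
- move=> x y [c Gx] [d Gy]; exists (c + d) => /=.
  by rewrite scalerDl opprD addrACA; exact: (GD _ _ Gx Gy).
- move=> a x [c Gx]; exists (a * c) => /=.
  by rewrite -scalerA -scalerBr; exact: (GZ a _ Gx).
- move=> m [c /=]; rewrite sub0r => Gcb; have [j [w [cbE Dcb _]]] := cbP c.
  have cb0 : c *: b = 0.
    rewrite cbE -scalerA pb_big ?scaler0 //; apply: Dcb.
    by rewrite -[c *: b]opprK; apply: (smN (U := D)); exists m.
  by apply: Gfun; rewrite cb0 oppr0 in Gcb.
- by move=> a; exists 0; rewrite scale0r subr0; exact: Gi.
move=> l y m [c /= Gy]; have [j [w [cbE _ Dt]]] := cbP c.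
suff [u [c' uE] [d [m' [Gd dE]]]] : exists2 u, exists c', u = c' *: b &
    exists d m', G (d, m') /\
      e * p ^+ l *: y - e * p ^+ l *: u = e * p ^+ l *: d.
  exists (d + u), m'; split; first by exists c'; rewrite /= uE addrK.
  by rewrite scalerDr -dE subrK.
have [lt_kj|le_jk] := ltnP k j.
  exists 0; first by exists 0; rewrite scale0r.
  have cb0 : c *: b = 0 by rewrite cbE -scalerA pb_big // scaler0.
  by rewrite scaler0 subr0; move: Gy; rewrite cb0 subr0; exact: Gpure.
have [le_lj|lt_jl] := leqP l j.
  exists ((w * p ^+ (j - l)) *: b); first by exists (w * p ^+ (j - l)).
  have uE : c *: b = e * p ^+ l *: (w * p ^+ (j - l) *: b).
    rewrite cbE -[in LHS](subnK le_lj) exprD -eb !scalerA.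
    have -> : e * p ^+ l * (w * p ^+ (j - l)) * e =
              w * (p ^+ (j - l) * p ^+ l) * (e * e) by ring.
    by rewrite ee.
  by move: Gy; rewrite uE -scalerBr; exact: Gpure.
case: Db; have Dy : D (p ^+ (k.+1 - l) * (e * p ^+ l) *: y).
  have -> : p ^+ (k.+1 - l) * (e * p ^+ l) =
            p ^+ (k.+1 - l + l - k.+1) * (e * p ^+ k.+1).
    by rewrite mulrCA [RHS]mulrCA -!exprD; congr (e * p ^+ _); lia.
  by rewrite -scalerA; apply: (smZ (U := D)); exact: Dk.
have Dcb : D (p ^+ (k.+1 - l) * c *: b).
  rewrite -scalerA -[c *: b](subKr (e * p ^+ l *: y)) scalerBr scalerA.
  by apply: (smB (U := D)) => //; apply: (smZ (U := D)); exists m.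
have := Dt _ Dcb; rewrite -exprD => Dj.
have -> : k = (k - (k.+1 - l + j) + (k.+1 - l + j))%N by lia.
by rewrite exprD -scalerA; apply: (smZ (U := D)).
Qed.

Hypothesis i_inj : injective i.
Hypothesis i_pure : forall r a b, i a = r *: b -> exists a', a = r *: a'.

Lemma uniserial_extension :
  exists g : {linear B -> M}, forall a, g (i a) = f (e *: a).
Proof.
have [ee epn _] := eP.
have P0 : partial_extension [set x | exists a, x = (i a, f (e *: a))].
  split=> [|m [a [/esym/eqP]]|a|j b m [a [bE mE]]].
  - split=> [|_ _ [a ->] [a' ->]|c _ [a ->]].
    + by exists 0; rewrite scaler0 !linear0.
    + by exists (a + a'); rewrite scalerDr !linearD.
    exists (c *: a); rewrite scalerA [e * c]mulrC -scalerA.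
      by rewrite (linearZ_LR i) (linearZ_LR f c).
  - by rewrite -(linear0 i) (inj_eq i_inj) => /eqP-> ->; rewrite scaler0 linear0.
  - by exists a.
  have [a' aE] := i_pure (esym bE).
  by exists (i a'), (f (e *: a')); split; [exists a'|rewrite bE aE linearZ_LR].
have [G PG maxG] := Zorn_nonempty_chains P0 partial_extension_bigcup.
have [[G0 GD GZ] Gfun Gi Gpure] := PG.
pose D := Submodule (graph_dom_is_submodule PG).
have De b : D (e *: b).
  apply: contrapT => Deb.
  pose Pk k := `[< forall y, D (e * p ^+ k *: y) >].
  have exPk : exists k, Pk k.
    by exists n; apply/asboolP => y; rewrite epn scale0r; exact: sm0.
  case: (ex_minnP exPk) => -[/asboolP/(_ b)|k /asboolP Dk min_k].
    by rewrite expr0 mulr1.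
  have [y Dy] : exists y, ~ D (e * p ^+ k *: y).
    apply: contrapT => /forallNP h; have /min_k : Pk k; last by rewrite ltnn.
    by apply/asboolP => y; apply: contrapT => /h.
  have [m Gm] := Dk y; have [d [m' [Gd dE]]] := Gpure _ _ _ Gm.
  pose b' := e *: (y - d).
  have Db' : ~ D (p ^+ k *: b').
    rewrite /b' scalerA mulrC scalerBr => /smBK h; apply: Dy; apply: h.
    by apply: smZ; exists m'.
  have PG' := @partial_extension_step G k b' PG _ _ Db' Dk.
  have : G (b', 0).
    apply: (maxG _ (PG' _ _)) => [||[x z] Gx|].
    - by rewrite /b' scalerA ee.
    - by rewrite /b' scalerA mulrC scalerBr dE subrr.
    - by exists 0; rewrite scale0r subr0.
    by exists 1; rewrite /= scale1r subrr.
  by move=> Gb'; apply/Db'/smZ; exists 0.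
have [g gE] := choice De.
have [|h hE] := @exists_linear Q B M g.
  move=> a x y; apply/eqP; rewrite -subr_eq0; apply/eqP/Gfun.
  have := GD _ _ (gE (a *: x + y)) (GZ (-1) _ (GD _ _ (GZ a _ (gE x)) (gE y))).
  rewrite !scaleN1r; congr (G (_, _)).
  by rewrite scalerDr scalerA mulrC -scalerA; exact: subrr.
exists h => a; rewrite hE; apply/eqP; rewrite -subr_eq0; apply/eqP/Gfun.
have := GD _ _ (gE (i a)) (GZ (-1) _ (GZ e _ (Gi a))).
rewrite !scaleN1r; congr (G (_, _)); first exact: subrr.
by congr (_ - _); rewrite /= -linearZ_LR scalerA ee.
Qed.

End UniserialExtension.

(** * Annihilators along chains of principal ideals *)

Definition ann_chain_condition (R : comPzRingType) : Prop :=
  forall b : nat -> R, (forall k, exists a, b k.+1 = b k * a) ->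
  exists k, forall x, x * b k.+1 = 0 -> x * b k = 0.

(** Locally, one of the ideals [a R] and [b R] contains the other; the pair [s],
    [1 - s] is a partition of unity between the two cases. *)
Definition locally_comparable (R : comPzRingType) : Prop :=
  forall a b : R, exists s c d, s * a = c * b /\ (1 - s) * b = d * a.

(** The chain condition, read as well-foundedness of the relation of being a
    multiple with a larger annihilator. *)
Lemma ann_minimal (R : comPzRingType) (X : set R) x0 :
  ann_chain_condition R -> X x0 ->
  exists2 b, X b & forall a, X (b * a) -> forall x, x * (b * a) = 0 -> x * b = 0.
Proof.
move=> accR Xx0; apply: contrapT => nomin.
have [next nextP] : exists f : R -> R, forall b, X b ->
    X (b * f b) /\ ~ (forall x, x * (b * f b) = 0 -> x * b = 0).
  suff /choice[f fP] : forall b, exists a, X b ->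
      X (b * a) /\ ~ (forall x, x * (b * a) = 0 -> x * b = 0) by exists f.
  move=> b; apply: contrapT => /forallNP h; apply: nomin; exists b.
    by apply: contrapT => Xb; apply: (h 0) => /Xb.
  move=> a Xba; apply: contrapT => nx; apply: (h a); by split.
pose b k := iter k (fun x => x * next x) x0.
have Xb k : X (b k) by elim: k => //= k /nextP[].
have [k hk] := accR b (fun k => ex_intro _ (next (b k)) erefl).
by have [_] := nextP _ (Xb k); apply.
Qed.

Lemma exists_maximal_ideal (R : comPzRingType) (J : set R) :
  is_ideal J -> ~ J 1 -> exists2 L, maximal_ideal L & J `<=` L.
Proof.
move=> JI J1.
pose P (X : set R) := [/\ is_ideal X, ~ X 1 & J `<=` X].
have [|F FP totF [X0 FX0]|L [LI L1 JL] maxL] := @Zorn_nonempty_chains R P J.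
- by split.
- split; last by move=> x Jx; exists X0 => //; have [_ _] := FP X0 FX0; exact.
  split; first by exists X0 => //; have [[]] := FP X0 FX0.
    move=> x y [X FX Xx] [Y FY Yy]; have [XY|YX] := totF X Y FX FY.
      by exists Y => //; have [[_ YD _] _ _] := FP Y FY; apply: YD => //; exact: XY.
    by exists X => //; have [[_ XD _] _ _] := FP X FX; apply: XD => //; exact: YX.
  by move=> a x [X FX Xx]; exists X => //; have [[_ _ XM] _ _] := FP X FX; exact: XM.
  by move=> [X FX X1]; have [_] := FP X FX.
exists L => //; split=> // [LT|K KI LK]; first by apply: L1; rewrite LT.
have [K1|K1] := pselect (K 1).
  right; apply/seteqP; split=> // x _; rewrite -[x]mulr1.
  by have [_ _ KM] := KI; exact: KM.
left; apply/seteqP; split=> //; apply: maxL => //; split=> //.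
exact: subset_trans LK.
Qed.

(** The elements that send [a] into [b R] and those that send [b] into [a R]
    generate an ideal [J].  At a maximal ideal one of the localized principal
    ideals contains the other, and clearing denominators produces an element of
    [J] outside the maximal ideal; so [J] contains [1]. *)
Lemma arithmetical_comparable (R : comPzRingType) :
  arithmetical R -> locally_comparable R.
Proof.
move=> arithR a b.
pose J := [set z | exists x y c d, [/\ z = x + y, x * a = c * b & y * b = d * a]].
have JI : is_ideal J.
  split; first by exists 0, 0, 0, 0; rewrite addr0 !mul0r.
    move=> _ _ [x [y [c [d [-> xE yE]]]]] [x' [y' [c' [d' [-> xE' yE']]]]].
    exists (x + x'), (y + y'), (c + c'), (d + d').
    by split; [ring | rewrite !mulrDl xE xE' | rewrite !mulrDl yE yE'].
  move=> t _ [x [y [c [d [-> xE yE]]]]].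
  exists (t * x), (t * y), (t * c), (t * d).
  by split; [ring | rewrite -!mulrA xE | rewrite -!mulrA yE].
suff [x [y [c [d [e xE yE]]]]] : J 1.
  by exists x, c, d; split=> //; rewrite e [x + y]addrC addrK.
apply: contrapT => /(exists_maximal_ideal JI)[L maxL JL].
pose S := maximal_compl maxL.
pose frac x : localization S := mkloc (S := S) x (mulset1 S).
pose I x : set (localization S) := [set q | exists z, q = z * frac x].
have II x : is_ideal (I x).
  split; first by exists 0; rewrite mul0r.
    by move=> _ _ [z ->] [z' ->]; exists (z + z'); rewrite mulrDl.
  by move=> t _ [z ->]; exists (t * z); rewrite mulrA.
have sub x y : I x `<=` I y -> exists2 s, ~ L s & exists c, s * x = c * y.
  move=> xy; have [z] : I y (frac x) by apply: xy; exists 1; rewrite mul1r.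
  elim/mkloc_ind: z => c s Ss /=.
  rewrite [RHS](loc_mulE c Ss y (mulset1 S)) => /mklocP[u Su].
  move=> e; exists (u * (s * 1)); last by exists (u * c); rewrite mulrAC -mulrA e; ring.
  by apply: (maximal_complM maxL) => //; rewrite mulr1.
have [/sub[s Ls [c e]]|/sub[s Ls [c e]]] := arithR L maxL _ _ (II a) (II b).
  by apply/Ls/JL; exists s, 0, c, 0; rewrite addr0 !mul0r.
by apply/Ls/JL; exists 0, s, 0, c; rewrite add0r !mul0r.
Qed.

Section TotalArithmetical.
Variable Q : comPzRingType.
Hypotheses (accQ : ann_chain_condition Q) (cmpQ : locally_comparable Q).

(** If the ideal [ann b + ann (ann b)] were contained in a maximal ideal [L],
    an element [u] outside [L] with largest annihilator would kill [ann b], and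
    so belong to [L]: locally at [L] the element [b] is comparable with each [x] in [ann b], and
    as [ann b] meets [b Q] trivially, either [b] or [x] vanishes there. *)
Lemma stable_annihilator_idempotent b :
  (forall x, x * (b * b) = 0 -> x * b = 0) ->
  exists s, s * b = 0 /\ forall x : Q, x * b = 0 -> s * x = x.
Proof.
move=> stab.
pose J := [set z | exists x y, [/\ z = x + y, x * b = 0 &
  forall t, t * b = 0 -> y * t = 0]].
have JI : is_ideal J.
  split; first by exists 0, 0; rewrite addr0 mul0r; split=> // t; rewrite mul0r.
    move=> _ _ [x [y [-> xb yt]]] [x' [y' [-> xb' yt']]]; exists (x + x'), (y + y').
    split=> [||t tb]; first by ring.
      by rewrite mulrDl xb xb' addr0.
    by rewrite mulrDl yt // yt' // addr0.
  move=> c _ [x [y [-> xb yt]]]; exists (c * x), (c * y).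
  split=> [||t tb]; [by ring | by rewrite -mulrA xb mulr0 |].
  by rewrite -mulrA yt // mulr0.
suff [s [y [e sb yt]]] : J 1.
  exists s; split=> // x xb; rewrite -[RHS]mul1r e mulrDl (yt x xb).
  by rewrite addr0.
apply: contrapT => /(exists_maximal_ideal JI)[L maxL JL].
have [u Lu umin] := ann_minimal accQ (maximal_compl1 maxL : (~` L) 1).
apply: (Lu); apply: (JL); exists 0, u; rewrite add0r mul0r; split=> // x xb.
have kill s : ~ L s -> s * x = 0 -> u * x = 0.
  move=> Ls sx; rewrite mulrC; apply: (umin s).
    exact: (maximal_complM maxL Lu Ls).
  by rewrite mulrCA [x * s]mulrC sx mulr0.
have [s [c [d [sx sb]]]] := cmpQ x b.
have [Ls|Ls] := pselect (L s); last first.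
  apply: (kill s Ls); rewrite sx; apply: stab.
  by rewrite mulrA -sx -mulrA xb mulr0.
have Ls1 : L (1 - s).
  apply: JL; exists (1 - s), 0; rewrite addr0; split=> // [|t _].
    by apply: stab; rewrite mulrA sb -mulrA xb mulr0.
  by rewrite mul0r.
have [[_ LD _] _ _] := maxL.
by case: (maximal_compl1 maxL); rewrite -(subrK s 1); exact: LD.
Qed.

Hypothesis totalQ : forall q : Q, GRing.lreg q -> exists w, q * w = 1.

(** A power [b] of [a] has a stable annihilator.  The idempotent [s] attached to
    it vanishes where [b] is regular and is [1] where [b] vanishes, so [b + s] is
    regular, hence invertible. *)
Lemma fitting_idempotent (a : Q) :
  exists (s : Q) k (w : Q), [/\ s * s = s, s * a ^+ k.+1 = 0 & a ^+ k.+1 * w = 1 - s].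
Proof.
have [|_ [k ->] kmin] :=
  @ann_minimal Q [set y | exists k, y = a ^+ k.+1] a accQ; first by exists 0%N.
set b := a ^+ k.+1 in kmin *.
have stab x : x * (b * b) = 0 -> x * b = 0.
  by apply: kmin; exists (k + k.+1)%N; rewrite /b -exprD.
have [s [sb sx]] := stable_annihilator_idempotent stab.
have ss : s * s = s by exact: sx.
have [|w bsw] := @totalQ (b + s).
  have reg x : (b + s) * x = 0 -> x = 0.
    move=> bsx; have sx0 : s * x = 0.
      have : s * ((b + s) * x) = 0 by rewrite bsx mulr0.
      by rewrite mulrA mulrDr sb ss add0r.
    rewrite -(sx x) // mulrC; move: bsx.
    by rewrite mulrDl sx0 addr0.
  move=> x y e; apply/eqP; rewrite -subr_eq0; apply/eqP/reg.
  by rewrite mulrBr e subrr.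
exists s, k, w; split=> //; rewrite -/b.
have -> : b * w = (b + s) * w - s * ((b + s) * w).
  rewrite mulrDl mulrDr mulrA sb mul0r add0r [s * (s * w)]mulrA ss.
  by rewrite addrK.
by rewrite bsw mulr1.
Qed.

Definition primitive (e : Q) : Prop :=
  e * e = e /\ forall e', e' * e' = e' -> e * e' = e' -> e' = 0 \/ e' = e.

Section Primitive.
Variable e : Q.
Hypothesis prim_e : primitive e.

Let ee : e * e = e. Proof. by case: prim_e. Qed.

Definition nil_at (a : Q) : Prop := exists n, e * a ^+ n = 0.
Definition unit_at (a : Q) : Prop := exists w, e * (a * w) = e.

(** The Fitting idempotent of [a] splits [e], hence is trivial on [e Q]. *)
Lemma nil_or_unit a : nil_at a \/ unit_at a.
Proof.
have [s [k [w [ss sa aw]]]] := fitting_idempotent a.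
have [||es|es] := (prim_e.2 (e * s)).
- by rewrite mulrACA ee ss.
- by rewrite mulrA ee.
- right; exists (a ^+ k * w); rewrite [a * _]mulrA -exprS aw mulrBr es mulr1.
  by rewrite subr0.
by left; exists k.+1; rewrite -es -mulrA sa mulr0.
Qed.

Lemma nil_stable y c : e * y = y -> nil_at c ->
  (forall x, x * (y * c) = 0 -> x * y = 0) -> y = 0.
Proof.
move=> ey [m ecm] stab; have : y * c ^+ m = 0.
  by rewrite -ey mulrAC ecm mul0r.
elim: m {ecm} => [|m IHm]; first by rewrite expr0 mulr1.
by rewrite exprSr mulrCA => /stab; rewrite mulrC.
Qed.

(** As [e Q] is local, one of [s] and [1 - s] is invertible there. *)
Lemma primitive_comparable a b :
  (exists c, e * a = e * (c * b)) \/ (exists d, e * b = e * (d * a)).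
Proof.
have [s [c [d [sa sb]]]] := cmpQ a b.
have [[n esn]|[w esw]] := nil_or_unit s; [right|left].
  exists ((\sum_(i < n) s ^+ i) * d).
  rewrite -mulrA -sb [RHS]mulrA -[X in _ = X]mulrA.
  have -> : e * ((\sum_(i < n) s ^+ i) * ((1 - s) * b)) =
            (e - e * s ^+ n) * b.
    rewrite -[e - _](_ : e * (1 - s ^+ n) = _); last by ring.
    by rewrite -[1 - s ^+ n]opprB subrX1; ring.
  by rewrite esn subr0.
exists (w * c); rewrite -mulrA -sa -{1}esw; ring.
Qed.

(** Otherwise an element [p0] that is nilpotent in [e Q] and nonzero there has an
    infinite chain of factorizations [p0 = c1 p1], [p1 = c2 p2], ... in [e Q] with
    nilpotent factors, and the products [c1 c2 ... ck] have strictly growing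
    annihilators. *)
Lemma nil_at_principal :
  exists2 p, nil_at p & forall a, nil_at a -> exists c, e * a = e * (c * p).
Proof.
apply: contrapT => nop.
have factor p : nil_at p -> exists c a,
    [/\ nil_at c, nil_at a & e * p = e * (c * a)].
  move=> Np; apply: contrapT => h; apply: nop; exists p => // a Na.
  have [//|[c ep]] := primitive_comparable a p.
  have [Nc|[w ecw]] := nil_or_unit c; first by case: h; exists c, a.
  exists w; transitivity (w * (e * p)); last by ring.
  by rewrite ep -{1}ecw; ring.
have [p0 Np0 ep0] : exists2 p, nil_at p & e * p <> 0.
  apply: contrapT => h; apply: nop; exists 0; first by exists 1%N; rewrite mulr0.
  move=> a Na; exists 0; rewrite mul0r mulr0; apply: contrapT => ea.
  by apply: h; exists a.
pose X y := exists c p, [/\ y = e * c, nil_at p & e * p0 = e * (c * p)].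
have [|_ [c [p [-> Np ep0E]]] ymin] := @ann_minimal Q X e accQ.
  by exists 1, p0; rewrite mulr1 mul1r.
have [d [a [Nd Na epE]]] := factor p Np.
have ec0 : e * c = 0.
  apply: (nil_stable _ Nd); first by rewrite mulrA ee.
  apply: ymin; exists (c * d), a; split=> //; first by ring.
  by rewrite ep0E mulrCA epE; ring.
by apply: ep0; rewrite ep0E mulrA ec0 mul0r.
Qed.

(** Dividing [r] by [p] as long as the quotient stays nilpotent stops after at
    most [n] steps, with a unit or with zero. *)
Lemma primitive_uniserial : exists p n, uniserial_idempotent e p n.
Proof.
have [p [n epn] pgen] := nil_at_principal; exists p, n; split=> // r.
have [//|[r' erE]] : (exists j w w', e * r = e * (w * p ^+ j) /\
    e * p ^+ j = e * (w' * r)) \/ exists r', e * r = e * (r' * p ^+ n).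
  elim: n {epn} => [|n [IHn|[r' erE]]]; [|by left|].
    by right; exists r; rewrite expr0 mulr1.
  have [Nr'|[w er'w]] := nil_or_unit r'.
    have [c ecE] := pgen _ Nr'; right; exists c.
    by rewrite erE exprS mulrA ecE; ring.
  left; exists n, r', w; split=> //.
  transitivity (w * (e * r)); last by ring.
  by rewrite erE -{1}er'w; ring.
exists n, 0, 0; rewrite !mul0r mulr0 epn; split=> //.
by rewrite erE mulrCA epn mulr0.
Qed.

End Primitive.

Definition extension_property (e : Q) : Prop :=
  forall (A B M : lmodType Q) (i : {linear A -> B}) (f : {linear A -> M}),
    injective i -> (forall r a b, i a = r *: b -> exists a', a = r *: a') ->
    exists g : {linear B -> M}, forall a, g (i a) = f (e *: a).

(** The chain condition on annihilators is well-foundedness of the divisibility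
    order on idempotents, so that the property is checked on the primitive ones,
    and a sum of two idempotents inherits it. *)
Lemma idempotent_extension e : e * e = e -> extension_property e.
Proof.
move=> e_idem; apply: contrapT => e_bad.
have [|{e_idem e_bad}e [ee bad] emin] :=
  @ann_minimal Q [set e | e * e = e /\ ~ extension_property e] e accQ.
  by split.
have good e' : e' * e' = e' -> e * e' = e' -> e' <> e -> extension_property e'.
  move=> e'e' ee' neq; apply: contrapT => bad'.
  have := emin e' _ (1 - e'); rewrite ee' => /(_ (conj e'e' bad')).
  rewrite mulrBl mul1r e'e' subrr => /(_ erefl)/eqP.
  by rewrite mulrBl mul1r mulrC ee' subr_eq0 => /eqP/esym.
case: bad => A B M i f inji purei.
have [prim_e|nprim] := pselect (primitive e).
  have [p [n eP]] := primitive_uniserial prim_e.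
  exact: uniserial_extension eP _ _ _ _ f inji purei.
have [e' [e'e' ee' e'0 e'e]] :
    exists e', [/\ e' * e' = e', e * e' = e', e' <> 0 & e' <> e].
  apply: contrapT => /forallNP h; apply: nprim; split=> // e' e'e' ee'.
  by apply: contrapT => /not_orP[? ?]; apply: (h e').
have [g1 g1E] := good e' e'e' ee' e'e A B M i f inji purei.
have [|||g2 g2E] := good (e - e') _ _ _ A B M i f inji purei.
- by rewrite mulrBl !mulrBr ee ee' e'e' mulrC ee' subrr subr0.
- by rewrite mulrBr ee ee'.
- by move/eqP; rewrite subr_eq addrC -subr_eq subrr => /eqP/esym.
have [|g gE] := @exists_linear Q B M (fun b => g1 b + g2 b).
  by move=> c x y; rewrite !linearP scalerDr addrACA.
by exists g => a; rewrite gE g1E g2E -linearD -scalerDl addrC subrK.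
Qed.

Lemma total_arithmetical_pure_semisimple : pure_semisimple Q.
Proof.
move=> M A B C i p pure f; have [[inji _ _] _] := pure.
have [g gE] := idempotent_extension (mulr1 1) f inji (pure_divisible pure).
by exists g => a; rewrite gE scale1r.
Qed.

End TotalArithmetical.

(** * The total ring of fractions *)

Section QuotientRing.
Variable R : comPzRingType.
Local Notation S := (regular_elements R).
Local Notation Q := (quotient_ring R).

Definition frac (a : R) : Q := mkloc (S := S) a (mulset1 S).

Lemma fracD a b : frac (a + b) = frac a + frac b.
Proof.
rewrite [RHS](loc_addE a (mulset1 S) b (mulset1 S)).
by apply: mkloc_eq; ring.
Qed.

Lemma fracM a b : frac (a * b) = frac a * frac b.
Proof.
rewrite [RHS](loc_mulE a (mulset1 S) b (mulset1 S)).
by apply: mkloc_eq; ring.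
Qed.

Lemma frac0 : frac 0 = 0. Proof. by []. Qed.

Lemma frac1 : frac 1 = 1. Proof. by []. Qed.

Lemma fracN a : frac (- a) = - frac a.
Proof. by apply/eqP; rewrite eq_sym eqr_oppLR -addr_eq0 -fracD subrr. Qed.

Lemma frac_inj : injective frac.
Proof. by move=> a b /mklocP[u /= ureg]; rewrite !mulr1 => /ureg. Qed.

Lemma frac_inv s : GRing.lreg s -> exists w, frac s * w = 1.
Proof.
move=> sreg; exists (mkloc (S := S) 1 (sreg : mulset S s)).
by rewrite [LHS](loc_mulE s (mulset1 S) 1 (_ : mulset S s)); apply: mkloc_eq; ring.
Qed.

Lemma frac_cancel s x : GRing.lreg s -> frac s * x = 0 -> x = 0.
Proof.
move=> /frac_inv[w sw] sx; rewrite -[x]mul1r -sw mulrAC sx.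
by rewrite mul0r.
Qed.

Lemma frac_denominator (q : Q) :
  exists s a, GRing.lreg s /\ frac s * q = frac a.
Proof.
elim/mkloc_ind: q => a s sreg; exists s, a; split=> //.
by rewrite [LHS](loc_mulE s (mulset1 S) a sreg); apply: mkloc_eq; ring.
Qed.

Lemma common_denominator m (c : nat -> Q) :
  exists2 s, GRing.lreg s &
    exists d : nat -> R, forall i, (i < m)%N -> frac s * c i = frac (d i).
Proof.
elim: m => [|m [s sreg [d dE]]]; first by exists 1; [exact: regular1 | exists (fun=> 0)].
have [t [a [treg tE]]] := frac_denominator (c m).
exists (s * t); first exact: regularM.
exists (fun i => if i == m then s * a else t * d i) => i; rewrite ltnS leq_eqVlt.
have [-> _|_ /= /dE dEi] := eqVneq i m; first by rewrite !fracM -mulrA tE.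
by rewrite !fracM -dEi mulrA [frac s * frac t]mulrC.
Qed.

Lemma quotient_ring_ann_chain : ann_chain_condition R -> ann_chain_condition Q.
Proof.
move=> accR b /choice[a bS].
have /choice[s /choice[r srE]] k := frac_denominator (a k).
have [t [b0 [treg tE]]] := frac_denominator (b 0%N).
have [c [c0 cS]] : exists c, c 0%N = b0 /\ forall k, c k.+1 = c k * r k.
  exists (fun k => b0 * \prod_(i < k) r i).
  by split=> [|k]; [rewrite big_ord0 mulr1 | rewrite big_ord_recr mulrA].
have cb k : exists2 u, GRing.lreg u & frac u * b k = frac (c k).
  elim: k => [|k [u ureg uE]]; first by exists t; rewrite ?c0.
  have [sreg sE] := srE k; exists (u * s k); first exact: regularM.
  by rewrite bS cS !fracM -uE -sE; ring.
have [k hk] := accR c (fun k => ex_intro _ (r k) (cS k)).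
exists k => x xb; have [v [y [vreg yE]]] := frac_denominator x.
have [[u ureg uE] [u' _ uE']] := (cb k, cb k.+1).
have : y * c k = 0.
  apply: hk; apply: frac_inj; rewrite fracM frac0 -uE' -yE.
  by transitivity (frac v * frac u' * (x * b k.+1)); [ring | rewrite xb mulr0].
move=> yc; apply: (frac_cancel vreg); apply: (frac_cancel ureg).
transitivity (frac (y * c k)); last by rewrite yc frac0.
by rewrite fracM -uE -yE; ring.
Qed.

Lemma quotient_ring_comparable : locally_comparable R -> locally_comparable Q.
Proof.
move=> cmpR p q; have [s [a [sreg pE]]] := frac_denominator p.
have [t [b [treg qE]]] := frac_denominator q.
have [[v sv] [w tw]] := (frac_inv sreg, frac_inv treg).
have [x [c [d [xa xb]]]] := cmpR a b.
have [pE' qE'] : p = v * frac a /\ q = w * frac b.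
  by rewrite -pE -qE !mulrA [v * _]mulrC [w * _]mulrC sv tw !mul1r.
exists (frac x), (v * frac c * frac t), (w * frac d * frac s); split.
  rewrite {1}pE' mulrCA -fracM xa fracM -qE; ring.
have -> : 1 - frac x = frac (1 - x) by rewrite fracD fracN frac1.
rewrite {1}qE' mulrCA -fracM xb fracM -pE; ring.
Qed.

Lemma quotient_ring_total (q : Q) : GRing.lreg q -> exists w, q * w = 1.
Proof.
move=> qreg; have [s [a [sreg qE]]] := frac_denominator q.
have areg : GRing.lreg a.
  move=> x y /= e; apply: frac_inj; apply: qreg.
  apply/eqP; rewrite -subr_eq0; apply/eqP/(frac_cancel sreg).
  by rewrite mulrBr !mulrA qE -!fracM e subrr.
have [w aw] := frac_inv areg; exists (frac s * w).
by rewrite mulrA [q * _]mulrC qE.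
Qed.

Lemma quotient_ring_pure_semisimple :
  arithmetical R -> ann_chain_condition R -> pure_semisimple Q.
Proof.
move=> /arithmetical_comparable cmpR accR.
apply: total_arithmetical_pure_semisimple.
- exact: quotient_ring_ann_chain.
- exact: quotient_ring_comparable.
exact: quotient_ring_total.
Qed.

(** Linear dependence over the quotient ring, with denominators cleared. *)
Definition depends (V : lmodType R) (l : seq V) (x : V) : Prop :=
  exists s, GRing.lreg s /\
    exists c : nat -> R, s *: x = \sum_(i < size l) c i *: l`_i.

(** A sequence of vectors each outside the span over [Q] of the preceding ones
    is excluded by [pure_semisimple_dependent]. *)
Lemma finite_dependence n (L : set 'rV[R]_n) : pure_semisimple Q ->
  exists l : seq 'rV[R]_n,
    (forall i, (i < size l)%N -> L l`_i) /\ forall x, L x -> depends l x.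
Proof.
move=> pssQ; apply: contrapT => nol.
have /choice[next nextP] (l : seq 'rV[R]_n) : exists x,
    (forall i, (i < size l)%N -> L l`_i) -> L x /\ ~ depends l x.
  have [Ll|Ll] := pselect (forall i, (i < size l)%N -> L l`_i); last by exists 0.
  apply: contrapT => /forallNP h; apply: nol; exists l; split=> // x Lx.
  by apply: contrapT => ndep; apply: (h x).
pose l k := iter k (fun l => rcons l (next l)) [::].
pose v k := next (l k).
have lE k : l k = mkseq v k by elim: k => // k IHk; rewrite mkseqS /= -/(l k) -IHk.
have Lv k : L (v k) /\ ~ depends (l k) (v k).
  elim/ltn_ind: k => k IHk; apply: nextP => i; rewrite lE size_mkseq => lt_ik.
  by rewrite nth_mkseq //; have [] := IHk i lt_ik.
pose V k : 'rV[Q]_n := \row_j frac (v k 0 j).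
have [|m [c VmE]] := pure_semisimple_dependent V pssQ.
  exists n, (fun i => delta_mx 0 i) => y; exists (fun i => y 0 i).
  exact: row_sum_delta.
have [s sreg [d dE]] := common_denominator m c.
have [_] := Lv m; apply; exists s; split=> //; exists d.
apply/rowP => j; rewrite lE size_mkseq !mxE summxE; apply: frac_inj.
rewrite fracM (big_morph frac fracD frac0).
have /rowP/(_ j) := VmE; rewrite !mxE summxE => ->.
rewrite mulr_sumr; apply: eq_bigr => i _.
by rewrite nth_mkseq // !mxE mulrA dE // fracM.
Qed.

End QuotientRing.

(** * Flat modules over a ring with noetherian quotient ring *)

Lemma linear_comb (R : pzRingType) (V W : lmodType R) (h : V -> W) (I : Type)
    (r : seq I) (c : I -> R) (x : I -> V) : linear h ->
  h (\sum_(i <- r) c i *: x i) = \sum_(i <- r) c i *: h (x i).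
Proof.
move=> /exists_linear[g gE]; rewrite -gE linear_sum; apply: eq_bigr => i _.
by rewrite linearZ_LR gE.
Qed.

Section TensorLemmas.
Variables (R : comPzRingType) (M A B : lmodType R) (f : {linear A -> B}).

Lemma tpure_linear_l (a : A) : linear (fun m : M => tpure m a).
Proof. by case: (tpure_bilinear M A) => _; exact. Qed.

Lemma tpure_linear_r (m : M) : linear (fun a : A => tpure m a).
Proof. by case: (tpure_bilinear M A). Qed.

Lemma tpureZ c (m : M) (a : A) : tpure (c *: m) a = tpure m (c *: a).
Proof.
have [h hE] := exists_linear (tpure_linear_l a).
have [k kE] := exists_linear (tpure_linear_r m).
by rewrite -hE -kE !linearZ_LR hE kE.
Qed.

Lemma tpure0l (a : A) : tpure (0 : M) a = 0.
Proof. by have [h hE] := exists_linear (tpure_linear_l a); rewrite -hE linear0. Qed.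

Lemma tpure0r (m : M) : tpure m (0 : A) = 0.
Proof. by have [h hE] := exists_linear (tpure_linear_r m); rewrite -hE linear0. Qed.

Lemma tensor_map_bilinear : bilinear_map (fun (m : M) a => tpure m (f a)).
Proof.
have [tl tr] := tpure_bilinear M B.
by split=> [m|a] c x y; [rewrite linearP; exact: tl | exact: (tr (f a))].
Qed.

Lemma tensor_map_linear : linear (tensor_map (M := M) f).
Proof. exact: (tlift_linear tensor_map_bilinear). Qed.

Lemma tensor_map_tpure m a : tensor_map (M := M) f (tpure m a) = tpure m (f a).
Proof. exact: (tlift_tpure _ _ tensor_map_bilinear). Qed.

Lemma flat_inj0 : flat M -> injective f ->
  forall z, tensor_map (M := M) f z = 0 -> z = 0.
Proof.
move=> flM finj z fz; apply: (flM A B f finj).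
by have [h hE] := exists_linear tensor_map_linear; rewrite fz -hE linear0.
Qed.

Lemma inj0_flat_map :
  (forall z, tensor_map (M := M) f z = 0 -> z = 0) ->
  injective (tensor_map (M := M) f).
Proof.
have [h hE] := exists_linear tensor_map_linear.
move=> h0 x y e; apply/eqP; rewrite -subr_eq0; apply/eqP/h0.
by rewrite -hE linearB !hE e subrr.
Qed.

End TensorLemmas.

(** Flatness applied to multiplication by [s] on [R]. *)
Lemma flat_regular (R : comPzRingType) (M : lmodType R) (s : R) (m : M) :
  flat M -> GRing.lreg s -> s *: m = 0 -> m = 0.
Proof.
move=> flM sreg sm.
have [f fE] : exists f : {linear R^o -> R^o}, forall x, f x = s * x.
  by apply: exists_linear => c x y; rewrite mulrDr /GRing.scale /= mulrCA.
have finj : injective f by move=> x y; rewrite !fE => /sreg.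
have : tpure m (1 : R^o) = 0.
  apply: (flat_inj0 flM finj); rewrite tensor_map_tpure fE.
  by rewrite -[s * 1]/(s *: (1 : R^o)) -tpureZ sm tpure0l.
have bb : bilinear_map (fun (m : M) (a : R^o) => a *: m).
  split=> [x|a] c u v; first by rewrite scalerDl -scalerA.
  by rewrite scalerDr !scalerA mulrC.
have [h hE] := exists_linear (tlift_linear bb).
move=> e; rewrite -[m]scale1r -(tlift_tpure m (1 : R^o) bb) e -hE.
exact: linear0.
Qed.

(** The relations [A] define a map [alpha] from [R^n] to [R^k] with kernel [K].
    Flatness makes the tensor product of [M] with the image of [alpha] embed in
    [M^k], so that the class of [m] in the tensor product of [M] with [R^n / K]
    vanishes; that is, [m] comes from the tensor product of [M] with [K]. *)
Lemma flat_relations (R : comPzRingType) (M : lmodType R) n k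
    (m : 'I_n -> M) (A : 'I_k -> 'rV[R]_n) :
  flat M -> (forall j, \sum_i A j 0 i *: m i = 0) ->
  exists p (B : 'I_p -> 'rV[R]_n) (y : 'I_p -> M),
    (forall i, m i = \sum_j B j 0 i *: y j) /\
    forall l j, \sum_i A l 0 i * B j 0 i = 0.
Proof.
move=> flM Am.
have [al alE] : exists al : {linear 'rV[R]_n -> 'rV[R]_k},
    forall v, al v = \row_j \sum_i A j 0 i * v 0 i.
  apply: exists_linear => c u v; apply/rowP => j; rewrite !mxE mulr_sumr.
  by rewrite -big_split; apply: eq_bigr => i _; rewrite !mxE mulrDr mulrCA.
have Ws : is_submodule [set w : 'I_n -> M | exists s : seq (M * 'rV[R]_n),
    (forall t, t \in s -> al t.2 = 0) /\ w = fun i => \sum_(t <- s) t.2 0 i *: t.1].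
  split=> [|_ _ [s [sK ->]] [s' [sK' ->]]|c _ [s [sK ->]]].
  - by exists [::]; split=> //; apply/funext => i; rewrite big_nil.
  - exists (s ++ s'); split=> [t|]; first by rewrite mem_cat => /orP[/sK|/sK'].
    by apply/funext => i; rewrite big_cat.
  exists [seq (c *: t.1, t.2) | t <- s]; split=> [_ /mapP[t /sK tK ->]|] //.
  apply/funext => i; rewrite big_map [LHS]scaler_sumr; apply: eq_bigr => t _.
  by rewrite !scalerA mulrC.
pose W := Submodule Ws.
have Is : is_submodule [set u | exists v, al v = u].
  split=> [|_ _ [u <-] [v <-]|c _ [u <-]]; first by exists 0; exact: linear0.
    by exists (u + v); exact: linearD.
  by exists (c *: u); exact: linearZ_LR.
pose I := Submodule Is.
have [lft lftP] := choice (fun u : submod I => submodP u).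
pose b (x : M) (u : submod I) := cls W (fun i => lft u 0 i *: x).
have bE x u v : al v = submod_val u -> b x u = cls W (fun i => v 0 i *: x).
  move=> alv; apply/clsP; exists [:: (x, lft u - v)]; split.
    by move=> t; rewrite inE => /eqP -> /=; rewrite linearB lftP alv subrr.
  apply/funext => i; rewrite big_seq1 /= !mxE scalerDl scaleNr.
  by [].
have bb : bilinear_map b.
  split=> [x c u v|u c x y].
    rewrite (bE x _ (c *: lft u + lft v)); last by rewrite linearP !lftP [RHS]linearP.
    rewrite /b -linearP; congr cls; apply/funext => i.
    by rewrite !mxE scalerDl -scalerA.
  rewrite /b -linearP; congr cls; apply/funext => i.
  by rewrite scalerDr scalerA mulrC -scalerA.
pose e i : 'rV[R]_n := delta_mx 0 i.
have alI i : I (al (e i)) by exists (e i).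
pose z := \sum_(i < n) tpure (m i) (to_submod (alI i)).
have z0 : z = 0.
  apply: (flat_inj0 (f := @submod_val _ _ I) flM); first exact: submod_val_inj.
  have [h hE] := exists_linear (tensor_map_linear (M := M) (@submod_val _ _ I)).
  rewrite -hE linear_sum.
  transitivity (\sum_j tpure (\sum_i A j 0 i *: m i) (delta_mx 0 j : 'rV[R]_k)).
    transitivity (\sum_i \sum_j A j 0 i *: tpure (m i) (delta_mx 0 j : 'rV[R]_k)).
      apply: eq_bigr => i _; rewrite hE tensor_map_tpure -[X in tpure _ X]/(al (e i)) [al _]row_sum_delta.
      rewrite (linear_comb _ _ _ (tpure_linear_r _)); apply: eq_bigr => j _.
      congr (_ *: _); rewrite alE mxE (bigD1 i) //= big1 ?addr0 => [|i' ne].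
        by rewrite mxE !eqxx mulr1.
      by rewrite mxE (negPf ne) andbF mulr0.
    rewrite exchange_big; apply: eq_bigr => j _ /=.
    by rewrite (linear_comb _ _ _ (tpure_linear_l _)).
  by rewrite big1 // => j _; rewrite Am tpure0l.
have /cls0P[s [sK mE]] : cls W m = 0.
  have [h hE] := exists_linear (tlift_linear bb).
  have mE : m = \sum_i (fun i' => e i 0 i' *: m i).
    apply/funext => i; rewrite fct_sumE (bigD1 i) //= big1 => [|i' ne].
      by rewrite mxE !eqxx scale1r addr0.
    by rewrite mxE eq_sym (negPf ne) andbF scale0r.
  rewrite -(linear0 h) -z0 [in LHS]mE !linear_sum; apply: eq_bigr => i _.
  by rewrite hE tlift_tpure // (bE _ _ (e i)).
pose t0 := (0 : M, 0 : 'rV[R]_n).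
exists (size s), (fun j => (nth t0 s j).2), (fun j => (nth t0 s j).1); split.
  by move=> i; rewrite mE (big_nth t0) big_mkord.
move=> l j; have := sK _ (mem_nth t0 (ltn_ord j)).
by rewrite alE => /rowP/(_ l); rewrite !mxE.
Qed.

Lemma row_free_module (R : pzRingType) p : free_module 'rV[R]_p.
Proof.
pose e i : 'rV[R]_p := delta_mx 0 i.
exists [set v | exists i, v = e i]; split.
  move=> s c us sB sum0 b bs; have [i eiE] := sB b bs.
  move/rowP: sum0 => /(_ i); rewrite summxE mxE (bigD1_seq _ bs us) /= big_seq_cond.
  rewrite big1 => [|_ /andP[/sB[j ->] nej]].
    by rewrite eiE !mxE !eqxx mulr1 addr0.
  rewrite !mxE [i == j](_ : _ = false) ?andbF ?mulr0 //.
  by apply: contraNF nej => /eqP ij; rewrite eiE ij.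
move=> y; exists [seq e i | i <- enum 'I_p], (fun b : 'rV[R]_p => \sum_i b 0 i * y 0 i).
split; first by move=> _ /mapP[i _ ->]; exists i.
rewrite big_map big_enum {1}[y]row_sum_delta; apply: eq_bigr => i _.
congr (_ *: _); rewrite (bigD1 i) //= big1 => [|j ne].
  by rewrite mxE !eqxx mul1r addr0.
by rewrite mxE (negPf ne) andbF mul0r.
Qed.

Section NoetherianQuotient.
Variable R : comPzRingType.
Hypothesis pssQ : pure_semisimple (quotient_ring R).

(** Over the noetherian ring [Q] the ideals [I_ t] are, up to regular
    multipliers, generated by elements of finitely many of them.  As regular
    elements act injectively on a flat module, a solution of these finitely many
    congruences solves all of them. *)
Lemma flat_semi_compact (M : lmodType R) : flat M -> semi_compact M.
Proof.
move=> flM T x_ I_ Iid fin.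
have [[t0 _]|noT] := pselect (exists t : T, True); last first.
  by exists 0 => t; case: noT; exists t.
have [l [lL dep]] :=
  @finite_dependence R 1 [set v : 'rV[R]_1 | exists t, I_ t (v 0 0)] pssQ.
have [t tP] : exists t : nat -> T, forall i, (i < size l)%N -> I_ (t i) (l`_i 0 0).
  suff /choice[t tP] : forall i, exists t, (i < size l)%N -> I_ t (l`_i 0 0) by exists t.
  move=> i; have [lt_i|] := ltnP i (size l); last by exists t0.
  by have [t It] := lL i lt_i; exists t.
pose K := [set t i | i in `I_(size l)].
have finK : finite_set K by apply: finite_image; exact: finite_II.
have [x xK] := fin K finK; exists x => u a Iua.
have [|y yK] := fin (K `|` [set u]).
  by rewrite finite_setU; split=> //; exact: finite_set1.
have ayx : a *: (y - x) = 0.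
  have [|s [sreg [c sE]]] := dep (const_mx a); first by exists u; rewrite mxE.
  apply: (flat_regular flM sreg).
  have -> : s *: (a *: (y - x)) = \sum_(i < size l) (c i * l`_i 0 0) *: (y - x).
    move/rowP: sE => /(_ 0); rewrite !mxE summxE => sE.
    rewrite scalerA sE scaler_suml; apply: eq_bigr => i _.
    by rewrite !mxE.
  rewrite big1 // => i _; rewrite -scalerA.
  have Kti : K (t i) by exists i => //=; exact: ltn_ord.
  have := xK _ Kti _ (tP i (ltn_ord i)); have := yK _ (or_introl Kti) _ (tP i (ltn_ord i)).
  rewrite -[y - x](subrKA (x_ (t i))) => e1 e2.
  rewrite [in X in _ *: X]scalerDr e1 -[x_ _ - x]opprB scalerN e2.
  by rewrite oppr0 addr0 scaler0.
have ay := yK u (or_intror erefl) a Iua.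
by rewrite -[x - x_ u](subrKA y) -[x - y]opprB scalerDr scalerN ay ayx oppr0 addr0.
Qed.

(** Only the relations that generate all others up to regular multipliers have
    to be respected by a map to a free module. *)
Lemma flat_finitely_projective (M : lmodType R) : flat M -> finitely_projective M.
Proof.
move=> flM N f [n [g gen]].
have [p pE] := exists_row_linear g.
have psurj z : exists v, p v = z.
  have [c ->] := gen z; exists (\row_i c i); rewrite pE.
  by apply: eq_bigr => i _; rewrite mxE.
have [l [lL dep]] := @finite_dependence R n [set v | p v = 0] pssQ.
have fpE v : f (p v) = \sum_i v 0 i *: f (g i).
  by rewrite pE linear_sum; apply: eq_bigr => i _; rewrite linearZ_LR.
have [|q [B [y [fgE AB]]]] :=
    @flat_relations _ M n (size l) (f \o g) (fun j => l`_j) flM.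
  by move=> j /=; rewrite -fpE lL // linear0.
have [be beE] := exists_row_linear (fun i => \row_j B j 0 i).
have [H HE] := exists_row_linear y.
have bel i : (i < size l)%N -> be l`_i = 0.
  move=> lt_i; apply/rowP => j; rewrite beE summxE mxE -[RHS](AB (Ordinal lt_i) j).
  by apply: eq_bigr => i' _; rewrite !mxE.
have [G GE] : exists G : {linear N -> 'rV[R]_q}, forall v, G (p v) = be v.
  apply: linear_factor => // v pv; have [s [sreg [c sE]]] := dep v pv.
  apply/rowP => j; rewrite [RHS]mxE; apply: sreg; rewrite mulr0.
  have -> : s * be v 0 j = be (s *: v) 0 j by rewrite linearZ_LR mxE.
  rewrite sE linear_sum big1 ?mxE // => i _.
  by rewrite linearZ_LR bel // scaler0.
exists 'rV[R]_q, G, H; split=> [|x]; first exact: row_free_module.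
have [v <-] := psurj x; rewrite GE fpE beE linear_sum; apply: eq_bigr => i _.
rewrite linearZ_LR HE (fgE i : f (g i) = _); congr (_ *: _).
apply: eq_bigr => j _.
by rewrite mxE.
Qed.

End NoetherianQuotient.

(** * Two flat modules of sequences *)

Fact zero_is_submodule (R : pzRingType) (V : lmodType R) : is_submodule [set x : V | x = 0].
Proof. by split=> [|_ _ -> ->|a _ ->]; rewrite ?addr0 ?scaler0. Qed.
Definition zero_submodule (R : pzRingType) (V : lmodType R) :=
  Submodule (zero_is_submodule V).

Definition finite_support (R : pzRingType) (V : lmodType R) : submodule (nat -> V) :=
  seq_ev_in (fun=> zero_submodule V).

Lemma flatI (R : comPzRingType) (M : lmodType R) :
  (forall (A B : lmodType R) (f : {linear A -> B}) z, injective f ->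
     tensor_map (M := M) f z = 0 -> z = 0) -> flat M.
Proof. by move=> h A B f finj; apply: inj0_flat_map => z; exact: h. Qed.

Lemma tensor_ind (R : comPzRingType) (M A : lmodType R) (P : tensor M A -> Prop) :
  P 0 -> (forall m a, P (tpure m a)) ->
  (forall x y, P x -> P y -> P (x + y)) -> forall z, P z.
Proof.
move=> P0 Pt PD z; rewrite -[z]reprK -[\pi_ _ _]/(tsum _) tsumE.
by elim/big_ind: _.
Qed.

Section CountableFree.
Variable R : comPzRingType.

Definition countable_free : lmodType R := submod (finite_support R^o).

Definition kronecker (i k : nat) : R^o := if k == i then 1 else 0.

Fact kronecker_finite i : finite_support R^o (kronecker i).
Proof. by exists i.+1 => k lt_ik; rewrite /kronecker /= gtn_eqF. Qed.
Definition countable_free_basis i : countable_free := to_submod (kronecker_finite i).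

Lemma countable_free_expansion (x : countable_free) :
  eventually (fun n => x = \sum_(i < n) submod_val x i *: countable_free_basis i).
Proof.
have [n0 hn0] := submodP x; exists n0 => n le_n; apply: submod_val_inj.
rewrite linear_sum; apply/funext => k; rewrite fct_sumE.
transitivity (\sum_(i < n) submod_val x i * kronecker i k); last first.
  by apply: eq_bigr => i _; rewrite linearZ_LR.
have [lt_kn|le_nk] := ltnP k n; last first.
  rewrite big1 => [|i _]; first by apply: hn0; exact: leq_trans le_nk.
  by rewrite /kronecker gtn_eqF ?mulr0 //; exact: leq_trans le_nk.
rewrite (bigD1 (Ordinal lt_kn)) //= big1 => [|i].
  by rewrite /kronecker eqxx mulr1 addr0.
rewrite -val_eqE /kronecker /= eq_sym => /negPf->.
by rewrite mulr0.
Qed.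

Lemma countable_free_flat : flat countable_free.
Proof.
apply: flatI => A B f z finj fz.
have [N /(_ N (leqnn N))[y zE]] : eventually (fun n => exists y : nat -> A,
    z = \sum_(i < n) tpure (countable_free_basis i) (y i)).
  elim/tensor_ind: {fz} z => [|x a|u v hu hv].
  - apply: eventuallyT => n; exists (fun=> 0); rewrite big1 // => i _.
    by rewrite tpure0r.
  - apply: eventually_mono (countable_free_expansion x) => n {1}->.
    exists (fun i => submod_val x i *: a).
    rewrite (linear_comb _ _ _ (tpure_linear_l a)); apply: eq_bigr => i _.
    have [h hE] := exists_linear (tpure_linear_r (countable_free_basis i) (A := A)).
    by rewrite -!hE linearZ_LR.
  apply: eventually_mono (eventually_and hu hv) => n [[y ->] [y' ->]].
  exists (fun i => y i + y' i); rewrite -big_split; apply: eq_bigr => i _.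
  have [h hE] := exists_linear (tpure_linear_r (countable_free_basis i) (A := A)).
  by rewrite -!hE linearD.
pose b (x : countable_free) (y : B) := fun k => submod_val x k *: y.
have bb : bilinear_map b.
  split=> [x c u v|u c x x']; apply/funext => k.
    by rewrite /b scalerDr scalerA mulrC -scalerA.
  by rewrite /b linearP scalerDl -scalerA.
have [h hE] := exists_linear (tlift_linear bb).
have [g gE] := exists_linear (tensor_map_linear (M := countable_free) f).
have : h (g z) = 0 by rewrite gE fz linear0.
rewrite zE linear_sum linear_sum => hz; rewrite big1 // => i _.
suff -> : y i = 0 by rewrite tpure0r.
apply: finj; rewrite linear0.
have -> : 0 = (\sum_(j < N) h (g (tpure (countable_free_basis j) (y j)))) i by rewrite hz.
rewrite fct_sumE (bigD1 i) //= big1 => [|j ne].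
  rewrite addr0 hE gE tensor_map_tpure tlift_tpure //.
  rewrite [RHS](_ : _ = (kronecker i i : R) *: f (y i)) //.
  by rewrite /kronecker eqxx scale1r.
rewrite hE gE tensor_map_tpure tlift_tpure //.
rewrite [LHS](_ : _ = (kronecker j i : R) *: f (y j)) //.
by rewrite /kronecker eq_sym val_eqE (negPf ne) scale0r.
Qed.

(** The congruences [x = sum of the b n e_n for n < k] modulo the elements killed
    by [ann (b k)] are compatible, since [b n] is killed by [ann (b k)] for
    [n >= k]; a solution has finite support, hence [ann (b m.+1)] kills [b m] for
    large [m]. *)
Lemma semi_compact_ann_chain :
  semi_compact countable_free -> ann_chain_condition R.
Proof.
move=> sc b bS.
have b_ann n k y : (k <= n)%N -> y * b k = 0 -> y * b n = 0.
  elim: n => [|n IHn]; first by rewrite leqn0 => /eqP->.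
  rewrite leq_eqVlt => /predU1P[-> //|]; rewrite ltnS => /IHn h /h yb.
  by have [a ->] := bS n; rewrite mulrA yb mul0r.
have xfin k : finite_support R^o (fun n => if (n < k)%N then b n else 0).
  by exists k => n le_kn; rewrite /= ltnNge le_kn.
have [|K finK|x xP] := sc nat (fun k => to_submod (xfin k))
    (fun k => [set y | y * b k = 0]).
- move=> k; split=> [|u v /= ub vb|c u /= ub]; rewrite /= ?mul0r //.
    by rewrite mulrDl ub vb addr0.
  by rewrite -mulrA ub mulr0.
- have [N KN] : exists N, forall k, K k -> (k <= N)%N.
    have /finite_seqP[s sE] := finK; exists (\max_(i <- s) i)%N => k.
    by rewrite sE => /= ks; exact: leq_bigmax_seq.
  exists (to_submod (xfin N)) => k Kk y yb.
  apply: submod_val_inj; apply/funext => n; rewrite linearZ_LR linearB linear0.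
  change (y * ((if (n < N)%N then b n else 0) - (if (n < k)%N then b n else 0)) = 0).
  have [lt_nk|le_kn] := ltnP n k; first by rewrite (leq_trans lt_nk (KN k Kk)) subrr mulr0.
  by case: ifP => _; rewrite subr0 ?mulr0 //; exact: b_ann yb.
have [m0 /(_ m0 (leqnn m0)) xm] := submodP x.
exists m0 => y yb; have /(congr1 (fun u => submod_val u m0)) := xP m0.+1 y yb.
rewrite linearZ_LR linearB linear0.
change (y * (submod_val x m0 - (if (m0 < m0.+1)%N then b m0 else 0)) = 0 -> y * b m0 = 0).
by rewrite xm ltnS leqnn sub0r mulrN => /eqP; rewrite oppr_eq0 => /eqP.
Qed.

End CountableFree.

Section BassModule.
Variables (R : comPzRingType) (a : nat -> R).

Local Notation germs V := (quotmod (finite_support V)).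

Definition transition (i k : nat) : R := \prod_(i <= j < k) a j.

Lemma transition_trans i j k : (i <= j <= k)%N ->
  transition i k = transition i j * transition j k.
Proof. by case/andP=> le_ij le_jk; rewrite /transition (big_cat_nat le_ij le_jk). Qed.

Definition bass_germ (i : nat) : germs R^o := cls (finite_support R^o) (transition i).

Lemma bass_germ_le i j : (i <= j)%N -> bass_germ i = transition i j *: bass_germ j.
Proof.
move=> le_ij; rewrite -linearZ_LR; apply/clsP; exists j => k le_jk.
change (transition i k - transition i j * transition j k = 0).
by rewrite (@transition_trans i j k) ?le_ij // subrr.
Qed.

Fact bass_is_submodule : is_submodule [set g | exists i r, g = r *: bass_germ i].
Proof.
split=> [|_ _ [i [r ->]] [j [s ->]]|c _ [i [r ->]]].
- by exists 0%N, 0; rewrite scale0r.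
- exists (i + j)%N, (r * transition i (i + j) + s * transition j (i + j)).
  rewrite (@bass_germ_le i (i + j)) ?leq_addr // (@bass_germ_le j (i + j)) ?leq_addl //.
  by rewrite !scalerA -scalerDl.
by exists i, (c * r); rewrite scalerA.
Qed.

(** The colimit of [R -> R -> R -> ...] along multiplication by [a 0], [a 1],
    ..., realized by the germs at infinity of sequences [x] that eventually
    satisfy [x k.+1 = a k * x k]: the generator of the [i]-th copy of [R]
    corresponds to the sequence of its images in the later copies. *)
Definition bass : lmodType R := submod (Submodule bass_is_submodule).

Fact bass_germ_in i : Submodule bass_is_submodule (bass_germ i).
Proof. by exists i, 1; rewrite scale1r. Qed.
Definition bass_gen i : bass := to_submod (bass_germ_in i).

Lemma bass_gen_le i j : (i <= j)%N -> bass_gen i = transition i j *: bass_gen j.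
Proof.
by move=> le_ij; apply: submod_val_inj; rewrite linearZ_LR; exact: bass_germ_le.
Qed.

Lemma bass_elim (m : bass) : exists i r, m = r *: bass_gen i.
Proof.
have [i [r mE]] := submodP m; exists i, r.
by apply: submod_val_inj; rewrite linearZ_LR.
Qed.

Lemma bass_gen_eq0 r i : r *: bass_gen i = 0 ->
  eventually (fun k => r * transition i k = 0).
Proof.
move=> /(congr1 (@submod_val _ _ _)); rewrite linearZ_LR linear0.
by rewrite /= -[X in _ *: X]/(bass_germ i) /bass_germ -linearZ_LR => /cls0P.
Qed.

Lemma bass_flat : flat bass.
Proof.
apply: flatI => A B f z finj fz.
have [i [x zE]] : exists i x, z = tpure (bass_gen i) x.
  elim/tensor_ind: {fz} z => [|m x|_ _ [i [x ->]] [j [y ->]]].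
  - by exists 0%N, 0; rewrite tpure0r.
  - by have [i [r ->]] := bass_elim m; exists i, (r *: x); rewrite tpureZ.
  exists (i + j)%N, (transition i (i + j) *: x + transition j (i + j) *: y).
  rewrite (@bass_gen_le i (i + j)) ?leq_addr // (@bass_gen_le j (i + j)) ?leq_addl //.
  have [h hE] := exists_linear (tpure_linear_r (bass_gen (i + j)) (A := A)).
  by rewrite !tpureZ -!hE linearD.
rewrite zE in fz *; rewrite tensor_map_tpure in fz.
pose b (m : bass) (y : B) : germs B :=
  cls _ (fun k => (repr (submod_val m) : nat -> R^o) k *: y).
have bE m u y : submod_val m = cls _ u -> b m y = cls _ (fun k => (u k : R) *: y).
  rewrite -[submod_val m]reprK => /clsP[n hn]; apply/clsP; exists n => k /hn /= uk.
  rewrite [LHS](_ : _ = (repr (submod_val m) k - u k) *: y).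
    by rewrite [X in X *: _]uk scale0r.
  by rewrite scalerBl.
have bb : bilinear_map b.
  split=> [m c y y'|y c m m'].
    rewrite /b -linearP; congr cls; apply/funext => k.
    by rewrite scalerDr scalerA mulrC -scalerA.
  rewrite (bE _ (c *: repr (submod_val m) + repr (submod_val m'))); last first.
    rewrite linearP [RHS]linearP.
    by congr (_ *: _ + _); exact/esym/reprK.
  rewrite /b -linearP; congr cls; apply/funext => k.
  by rewrite scalerDl -scalerA.
have [h hE] := exists_linear (tlift_linear bb).
have : b (bass_gen i) (f x) = 0 by rewrite -(tlift_tpure _ _ bb) -hE fz linear0.
rewrite (bE _ (transition i)) // => /cls0P[k hk].
have /= := hk (i + k)%N (leq_addl _ _); rewrite -linearZ_LR => fx.
rewrite (@bass_gen_le i (i + k)) ?leq_addr // tpureZ.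
by rewrite (_ : _ *: x = 0) ?tpure0r //; apply: finj; rewrite fx linear0.
Qed.

End BassModule.

(** Let [x0] be the first generator of the Bass module whose multipliers have
    the products [b k].  A factorization of the inclusion of [R x0] through a
    free module writes [x0] as a multiple [t] of a later generator, where
    [ann x0] is contained in [ann t].  For large [m] the element [b m] is a
    multiple of [t], so that [ann x0] kills [b m]; and [ann x0] contains
    [ann (b m.+1)]. *)
Lemma singly_projective_ann_chain (R : comPzRingType) :
  (forall M : lmodType R, flat M -> singly_projective M) -> ann_chain_condition R.
Proof.
move=> sp b /choice[q bS].
(* shifted so that the products of the multipliers are the b k, b 0 included *)
pose a k := if k is k'.+1 then q k' else b 0%N.
have bE k : transition a 0 k.+1 = b k.
  elim: k => [|k IHk]; first by rewrite /transition big_nat1.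
  by rewrite bS -IHk /transition big_nat_recr.
pose x := bass_gen a.
have Us : is_submodule [set y | exists r, y = r *: x 0%N].
  split=> [|_ _ [r ->] [s ->]|c _ [r ->]]; first by exists 0; rewrite scale0r.
    by exists (r + s); rewrite scalerDl.
  by exists (c * r); rewrite scalerA.
pose U := Submodule Us.
have Ux : U (x 0%N) by exists 1; rewrite scale1r.
have [|F [G [H [[B [Bindep Bspan]] fE]]]] :=
    sp _ (@bass_flat _ a) (submod U) (@submod_val _ _ U).
  exists (to_submod Ux) => y; have [r yE] := submodP y; exists r.
  by apply: submod_val_inj; rewrite linearZ_LR.
have [s [c [sB GE]]] := Bspan (G (to_submod Ux)).
pose c' y := c y *+ count_mem y s.
have GE' : G (to_submod Ux) = \sum_(y <- undup s) c' y *: y.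
  by rewrite GE -big_undup_iterop_count; apply: eq_bigr => y _; rewrite /c' -scalerMnl.
have [j [d dE]] : exists j (d : F -> R), forall y, y \in undup s -> H y = d y *: x j.
  have /choice[i /choice[r HE]] y := bass_elim (H y).
  exists (\max_(y <- undup s) i y)%N, (fun y => r y * transition a (i y) (\max_(y <- undup s) i y)%N).
  move=> y ys; rewrite HE -scalerA -bass_gen_le //.
  exact: leq_bigmax_seq.
pose t := \sum_(y <- undup s) c' y * d y.
have x0E : x 0%N = t *: x j.
  rewrite -[LHS]/(submod_val (to_submod Ux)) fE GE' linear_sum scaler_suml.
  by rewrite big_seq [RHS]big_seq; apply: eq_bigr => y ys; rewrite linearZ_LR dE // scalerA.
have [k hk] : eventually (fun k => (t - transition a 0 j) * transition a j k = 0).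
  by apply: bass_gen_eq0; rewrite scalerBl -bass_gen_le // -/(x 0%N) -/(x j) -x0E subrr.
pose m := (j + k)%N; exists m => r rb.
have bmE : b m = t * transition a j m.+1.
  rewrite -bE (@transition_trans R a 0 j m.+1); last by rewrite /m; lia.
  by apply/eqP; rewrite eq_sym -subr_eq0 -mulrBl hk // /m; lia.
have rx0 : r *: x 0%N = 0.
  by rewrite /x (@bass_gen_le R a 0 m.+2) // bE scalerA rb scale0r.
have rG : \sum_(y <- undup s) (r * c' y) *: y = 0.
  under eq_bigr => y _ do rewrite -scalerA.
  rewrite -scaler_sumr -GE' -linearZ_LR (_ : _ *: _ = 0) ?linear0 //.
  by apply: submod_val_inj; rewrite linearZ_LR.
have rc : forall y, y \in undup s -> r * c' y = 0.
  apply: (Bindep _ (fun y => r * c' y)) => //; first exact: undup_uniq.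
  by move=> y; rewrite mem_undup; exact: sB.
rewrite bmE mulrA mulr_sumr big_seq big1 ?mul0r // => y ys.
by rewrite mulrA rc // mul0r.
Qed.

(** * The equivalence *)

Lemma finitely_singly_projective (R : pzRingType) (M : lmodType R) :
  finitely_projective M -> singly_projective M.
Proof.
move=> fp N f [g gen]; apply: fp; exists 1%N, (fun=> g) => y.
by have [a ->] := gen y; exists (fun=> a); rewrite big_ord1.
Qed.

Theorem theorem3p1 (R : comPzRingType) (arithR : arithmetical R) :
  [<-> pure_semisimple (quotient_ring R);
       forall M : lmodType R, flat M -> semi_compact M;
       forall M : lmodType R, flat M -> finitely_projective M;
       forall M : lmodType R, flat M -> singly_projective M].
Proof.
tfae.
- by move=> pssQ M; exact: flat_semi_compact.
- move=> sc M; apply: flat_finitely_projective.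
  apply: quotient_ring_pure_semisimple => //.
  exact: semi_compact_ann_chain (sc _ (@countable_free_flat R)).
- by move=> fp M /fp; exact: finitely_singly_projective.
by move=> /singly_projective_ann_chain; exact: quotient_ring_pure_semisimple.
Qed.
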